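(* Let $G$ be a finite simple connected graph without isolated vertices (i.e. with at least one edge), and let $I(G)$ be its edge ideal. Then \[ \operatorname{vstab}(I(G)) = \min\{\lambda(U,V) \mid (U,V) \text{ is an admissible pair of subsets of } V(G)\}. \]
   Context: Let $G$ be a finite simple graph with vertex set $V(G)=\{1,\dots,n\}$ and edge set $E(G)$, let $\mathrm{k}$ be a field and $S=\mathrm{k}[x_1,\dots,x_n]$. The edge ideal of $G$ is $I(G)=(x_ix_j \mid \{i,j\}\in E(G))\subseteq S$. v-numbers. For an ideal $I$ of $S$ and $P\in\operatorname{Ass}(I)$ (associated primes of $S/I$), $v_P(I)=\min\{\deg f \mid f\in S,\ I:f=P\}$, and $v(I)=\min\{v_P(I)\mid P\in\operatorname{Ass}(I)\}$. For a homogeneous ideal $I$ the function $t\mapsto v(I^t)$ is eventually linear; $\operatorname{vstab}(I)$ denotes the smallest integer $t_0\ge 1$ such that $t\mapsto v(I^t)$ is linear (of the form $at+b$) for all $t\ge t_0$. Graph notation. For $U\subseteq V(G)$, $G[U]$ is the induced subgraph on $U$, $N_G(U)=\bigcup_{u\in U}N_G(u)$ is the set of all neighbors of vertices of $U$, and $N_G[U]=N_G(U)\cup U$. $G^2$ is the graph on $V(G)$ in which two distinct vertices are adjacent iff their distance in $G$ is at most $2$; $G^2[W]$ is its induced subgraph on $W$. A vertex cover of $G$ is a subset of $V(G)$ meeting every edge. A graph is strongly non-bipartite if each of its connected components is non-bipartite. A simple connected graph $H$ is factor-critical if $H-v$ has a perfect matching for every vertex $v$ of $H$. Parallelization. For a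 graph $H$ on $\{1,\dots,m\}$ and a vector $\mathbf a=(a_1,\dots,a_m)$ of positive integers, $H_{\mathbf a}$ is the graph obtained by replacing each vertex $i$ by $a_i$ copies $i_1,\dots,i_{a_i}$, with $\{i_k,j_\ell\}$ an edge iff $\{i,j\}\in E(H)$. Write $|\mathbf a|=a_1+\cdots+a_m$. Invariant $\mu^*$. For a connected non-bipartite graph $H$ on $m$ vertices, \[ \mu^*(H)=\min\left\{\tfrac{|\mathbf a|-1}{2}\ \middle|\ \mathbf a\in\mathbb{N}_{>0}^m \text{ and } H_{\mathbf a}\text{ is factor-critical}\right\}. \] For a strongly non-bipartite graph $H$ with connected components $H_1,\dots,H_c$, $\mu^*(H)=\mu^*(H_1)+\cdots+\mu^*(H_c)$. Admissible pairs. For a simple connected graph $G$, a pair $(U,V)$ of subsets of $V(G)$ is admissible if: (1) either $U=\emptyset$ or $G[U]$ is strongly non-bipartite; (2) $V$ is an independent set of $G$; (3) $N_G(U)\cap V=\emptyset$; (4) $G^2[U\cup V]$ is connected; (5) $N_G[U]\cup N_G(V)$ is a vertex cover of $G$. For an admissible pair, $\lambda(U,V)=\mu^*(G[U])+c(G[U])+|V|$, where $c(G[U])$ is the number of connected components of $G[U]$; by convention $\mu^*(G[\emptyset])=0$ and $c(G[\emptyset])=0$. *)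

(* Defs.v *)
From HB Require Import structures.
From mathcomp Require Import all_boot all_order all_algebra.
From mathcomp Require Import mpoly.
From Stdlib Require Import ClassicalEpsilon.
Set Implicit Arguments.
Unset Strict Implicit.
Unset Printing Implicit Defensive.

Import GRing.Theory.

Definition is_min (A : nat -> Prop) (m : nat) : Prop :=
  A m /\ forall l, A l -> m <= l.

(* Unspecified when [A] is empty. *)
Definition min_of (A : nat -> Prop) : nat := epsilon (inhabits 0) (is_min A).

Section Ideals.
Local Open Scope ring_scope.

Section ComRing.
Variable R : comNzRingType.
Implicit Types (I P A : R -> Prop) (f g : R).

Definition same_ideal I J : Prop := forall g, I g <-> J g.

Definition ideal_gen A : R -> Prop := fun f =>
  exists s : seq (R * R),
    (forall p, p \in s -> A p.2) /\ f = \sum_(p <- s) p.1 * p.2.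

Definition ideal_pow I (t : nat) : R -> Prop :=
  ideal_gen (fun f =>
    exists h : 'I_t -> R, (forall i, I (h i)) /\ f = \prod_(i < t) h i).

Definition colon I f : R -> Prop := fun g => I (g * f).

Definition is_ideal I : Prop :=
  [/\ I 0, forall f g, I f -> I g -> I (f + g) & forall f g, I g -> I (f * g)].

Definition prime_ideal P : Prop :=
  [/\ is_ideal P, ~ P 1 & forall f g, P (f * g) -> P f \/ P g].

(* P \in Ass(R/I) *)
Definition associated I P : Prop :=
  prime_ideal P /\ exists f, same_ideal (colon I f) P.

End ComRing.

Section VNumber.
Variables (k : fieldType) (n : nat).
Local Notation S := {mpoly k[n]}.
Implicit Types (I P : S -> Prop).

(* [(msize f).-1] is the total degree of [f]; the junk value at [f = 0] is
   harmless, since [colon I 0] is the whole ring. *)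
Definition v_at I P : nat :=
  min_of (fun d =>
    exists f : S, same_ideal (colon I f) P /\ d = (msize f).-1).

Definition v_number I : nat :=
  min_of (fun d => exists P, associated I P /\ d = v_at I P).

(* The intercept may be negative, hence coefficients in [int]. *)
Definition v_linear_from I (t0 : nat) : Prop :=
  exists a b : int, forall t : nat, (t0 <= t)%N ->
    (v_number (ideal_pow I t))%:Z = a * t%:Z + b.

Definition vstab I : nat :=
  min_of (fun t0 => (1 <= t0)%N /\ v_linear_from I t0).

Definition edge_ideal (e : rel 'I_n) : S -> Prop :=
  ideal_gen (fun f => exists i j, e i j /\ f = 'X_i * 'X_j).

End VNumber.
End Ideals.

Arguments edge_ideal k {n} e f.

(* A graph is a finite vertex type [T] with an adjacency relation [e : rel T]
   (symmetric and irreflexive in all uses). *)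
Section Graphs.
Implicit Type T : finType.

Definition induced T (e : rel T) (U : {set T}) : rel {x : T | x \in U} :=
  fun x y => e (val x) (val y).
#[global] Arguments induced {T} e U x y.

Definition connected T (e : rel T) : bool := [forall x, forall y, connect e x y].

Definition components T (e : rel T) : {set {set T}} :=
  equivalence_partition (connect e) [set: T].

Definition independent T (e : rel T) (V : {set T}) : bool :=
  [forall x in V, forall y in V, ~~ e x y].

Definition vertex_cover T (e : rel T) (C : {set T}) : bool :=
  [forall x, forall y, e x y ==> (x \in C) || (y \in C)].

Definition bipartite T (e : rel T) : bool :=
  [exists A : {set T}, independent e A && independent e (~: A)].

Definition strongly_nonbipartite T (e : rel T) : bool :=
  [forall C in components e, ~~ bipartite (induced e C)].

Definition edge_set T (e : rel T) : {set {set T}} :=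
  [set A : {set T} | [exists x, exists y, e x y && (A == [set x; y])]].

Definition has_perfect_matching T (e : rel T) : bool :=
  [exists M : {set {set T}}, (M \subset edge_set e) && partition M [set: T]].

Definition factor_critical T (e : rel T) : bool :=
  connected e && [forall v, has_perfect_matching (induced e [set~ v])].

Definition parallelization T (e : rel T) (a : T -> nat) :
    rel {i : T & 'I_(a i)} :=
  fun u v => e (tag u) (tag v).
#[global] Arguments parallelization {T} e a u v.

(* [|a|] is odd when the parallelization is factor-critical, so the halving
   is exact. *)
Definition mu_star_conn T (e : rel T) : nat :=
  min_of (fun m => exists a : T -> nat,
    [/\ forall i, 0 < a i, factor_critical (parallelization e a)
      & m = ((\sum_i a i).-1)./2]).

Definition mu_star T (e : rel T) : nat :=
  \sum_(C in components e) mu_star_conn (induced e C).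

Definition neighbors T (e : rel T) (U : {set T}) : {set T} :=
  [set y | [exists x in U, e x y]].

Definition closed_neighbors T (e : rel T) (U : {set T}) : {set T} :=
  neighbors e U :|: U.

(* The distance is at most [d]: there is a walk of length at most [d]. *)
Definition dist_le T (e : rel T) (d : nat) (x y : T) : bool :=
  [exists k : 'I_d.+1, exists p : k.-tuple T, path e x p && (last x p == y)].

Definition square T (e : rel T) : rel T :=
  fun x y => (x != y) && dist_le e 2 x y.

Definition admissible T (e : rel T) (U V : {set T}) : Prop :=
  [/\ U = set0 \/ strongly_nonbipartite (induced e U),
      independent e V,
      neighbors e U :&: V = set0,
      connected (induced (square e) (U :|: V))
    & vertex_cover e (closed_neighbors e U :|: neighbors e V)].

(* For [U = set0] both sums are empty, which gives the convention
   mu^*(G[set0]) = c(G[set0]) = 0. *)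
Definition lambda T (e : rel T) (U V : {set T}) : nat :=
  mu_star (induced e U) + #|components (induced e U)| + #|V|.

End Graphs.

(* Main.v *)
Require Import Defs.
From mathcomp Require Import mpoly.
From mathcomp Require Import all_boot all_order all_algebra.
From mathcomp Require Import zify.
From Stdlib Require Import Classical ClassicalEpsilon.
Set Implicit Arguments.
Unset Strict Implicit.
Unset Printing Implicit Defensive.

Import GRing.Theory.

(** A monomial is recorded by its exponent vector m, a product of edges by a
    list N of edges with its degree vector, so that membership of a monomial in
    I^t reads: m dominates the degree vector of a list of t edges
    ([edge_ideal_powP]).  A vertex v is exposable in m when m / x_v is a product
    of edges, and completable when m x_v is one.

    If P is prime and I^t : f = P, then P contains I, so for every edge xy one
    of x_x f, x_y f lies in I^t.  Hence deg f >= 2t - 1, and in case of equality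
    every monomial of f has degree 2t - 1 and its completable vertices form a
    vertex cover ([associated_witness]).  Conversely, for such a monomial m (a
    [short_witness] of t) the ideal I^t : m is generated by the variables of the
    completable vertices, because an augmenting path between two other variables
    can be rerouted through the vertex that m leaves exposed
    ([completable_cover]).  So v(I^t) >= 2t - 1, with equality exactly when t has
    a short witness ([v_numberP]).  Multiplying a witness by an edge gives a
    witness of t + 1, and concatenated even walks from a base point provide one
    ([even_spread]), so v(I^t) = 2t - 1 from some point on
    and vstab is the least t with a short witness ([vstab_short_witness]).

    It remains to compare witnesses with admissible pairs.  Let m be a witness
    and D the set of its exposable vertices; put the non-isolated vertices of
    G[D] in U and the isolated ones in V.  This is the deficiency one case of the
    Gallai-Edmonds decomposition.  An exchange argument ([alternating_exchange],
    [exposable_walk]) shows that no edge of a factorization of m / x_v, v in a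
    component K of G[U], leaves K towards a vertex outside K: the
    restriction of m to K is factor-critical.  Counting the edges that touch the
    components of G[D] then gives lambda(U,V) <= t ([witness_admissible]).
    Conversely, the components of an admissible pair, with optimal
    multiplicities, are glued one by one along middle vertices of paths of
    length two; each gluing keeps all vertices exposable ([glue]), and the
    resulting monomial is a witness of lambda(U,V) ([admissible_witness]). *)

(** * Degree vectors and alternating exchanges *)

Definition degree (T : finType) (N : seq (T * T)) (i : T) : nat :=
  \sum_(p <- N) ((p.1 == i) + (p.2 == i)).

(** Closes a linear goal between degree vectors evaluated at one vertex, where
    the incidence terms (v == i) count as arbitrary natural numbers.  Facts to be
    used must be in the goal. *)
Ltac count_lia :=
  repeat match goal with H : _ |- _ => clear H end;
  change (nat_of_bool true) with 1; change (nat_of_bool false) with 0;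
  repeat match goal with
  | |- context [nat_of_bool ?b] => move: (nat_of_bool b) => ?
  end;
  repeat match goal with
  | |- context [degree ?N ?i] => move: (degree N i) => ?
  end; lia.

Section Edges.
Variables (T : finType) (e : rel T).
Hypothesis e_sym : symmetric e.
Implicit Types (N R : seq (T * T)) (m : T -> nat).

Definition edges N : bool := all (fun p => e p.1 p.2) N.

(** The graph with m i copies of each vertex i has a perfect matching once a
    copy of v is deleted. *)
Definition exposable m v : Prop :=
  exists2 N, edges N & forall i, m i = (v == i) + degree N i.

Definition completable m v : Prop :=
  exists2 N, edges N & forall i, m i + (v == i) = degree N i.

Lemma degree_nil (i : T) : degree [::] i = 0.
Proof. by rewrite /degree big_nil. Qed.

Lemma degree_cons a b N i :
  degree ((a, b) :: N) i = (a == i) + (b == i) + degree N i.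
Proof. by rewrite /degree big_cons. Qed.

Lemma degree_rem N p i : p \in N ->
  degree N i = (p.1 == i) + (p.2 == i) + degree (rem p N) i.
Proof. by move=> pN; rewrite /degree (big_rem p pN). Qed.

Lemma degree_cat N R i : degree (N ++ R) i = degree N i + degree R i.
Proof. by rewrite /degree big_cat. Qed.

Lemma edges_cons a b N : edges ((a, b) :: N) = e a b && edges N.
Proof. by []. Qed.

Lemma edges_cat N R : edges (N ++ R) = edges N && edges R.
Proof. exact: all_cat. Qed.

Lemma edges_rem N p : edges N -> edges (rem p N).
Proof. by move=> /allP eN; apply/allP=> q /mem_rem/eN. Qed.

Lemma sum_in1 (B : {set T}) (z : T) : \sum_(i in B) (z == i : nat) = (z \in B).
Proof.
case: (boolP (z \in B)) => zB; last first.
  by rewrite big1 // => i iB; case: eqP zB => // ->; rewrite iB.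
rewrite (bigD1 z) //= eqxx big1 // => i /andP[_].
by rewrite eq_sym => /negbTE ->.
Qed.

Lemma sum_eq1 (v : T) : \sum_i (v == i : nat) = 1.
Proof.
transitivity (\sum_(i in [set: T]) (v == i : nat)).
  by apply: eq_bigl => i; rewrite inE.
by rewrite sum_in1 in_setT.
Qed.

Lemma sum_degree N : \sum_i degree N i = (size N).*2.
Proof.
elim: N => [|[a b] N IH].
  by rewrite big1 // => i _; rewrite degree_nil.
under eq_bigr do rewrite degree_cons.
by rewrite big_split /= IH big_split /= !sum_eq1; lia.
Qed.

(** Extracting the edge at a covered vertex: the single step of every
    alternating walk below. *)
Lemma take_edge N i : edges N -> 0 < degree N i ->
  exists j R, [/\ e i j, edges R, size N = (size R).+1
    & forall l, degree N l = (i == l) + (j == l) + degree R l].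
Proof.
elim: N => [|[a b] N IH]; first by rewrite degree_nil.
rewrite edges_cons degree_cons => /andP[eab eN].
case: (eqVneq a i) => [<- _|nai].
  by exists b, N; split=> // l; rewrite degree_cons.
case: (eqVneq b i) => [<- _|nbi].
  exists a, N; split=> //; first by rewrite e_sym.
  by move=> l; rewrite degree_cons; count_lia.
move=> /(IH eN)[j [R [eij eR sN dN]]].
exists j, ((a, b) :: R); split=> //=.
- by rewrite eab.
- by rewrite sN.
- by move=> l; rewrite !degree_cons dN; count_lia.
Qed.

(** Multiplying by an edge preserves exposability and, in the next lemma,
    completability.  This is what makes induction on alternating walks work: one
    step of the walk splits an edge off the monomial. *)
Lemma exposable_edge m m' a b v : e a b ->
  (forall i, m' i = (a == i) + (b == i) + m i) ->
  exposable m v -> exposable m' v.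
Proof.
move=> eab mE [N eN dN]; exists ((a, b) :: N); first by rewrite edges_cons eab.
by move=> i; rewrite degree_cons mE dN; count_lia.
Qed.

Lemma completable_edge m m' a b v : e a b ->
  (forall i, m' i = (a == i) + (b == i) + m i) ->
  completable m v -> completable m' v.
Proof.
move=> eab mE [N eN dN]; exists ((a, b) :: N); first by rewrite edges_cons eab.
by move=> i; rewrite degree_cons mE -dN; count_lia.
Qed.

Lemma exposable_completable m v w : e v w -> exposable m v -> completable m w.
Proof.
move=> evw [N eN dN]; exists ((v, w) :: N); first by rewrite edges_cons evw.
by move=> i; rewrite degree_cons dN; count_lia.
Qed.

Lemma completable_exposable m w :
  completable m w -> exists2 v, e v w & exposable m v.
Proof.
move=> [N eN dN].
have [|v [R [ewv eR _ dR]]] := @take_edge N w eN.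
  by rewrite -dN eqxx addn1.
exists v; first by rewrite e_sym.
by exists R => // i; have := dN i; rewrite dR; count_lia.
Qed.

(** Two factorizations of m, one exposing v and containing the edge xy, the other
    exposing p, are compared along the alternating walk that starts at v with an
    edge of the second.  Either the walk reaches p without using xy, and switching
    along it exposes p and keeps xy; or xy is met with y in an outer position of
    the walk, so y can be exposed; or y is in an inner position, and then the odd
    closed walk obtained by adding an edge vp would expose y.  The third
    alternative states this without assuming that vp is an edge. *)
Lemma alternating_exchange m v p x y R N1 : edges R -> edges N1 -> e x y ->
    (forall i, m i = (v == i) + (x == i) + (y == i) + degree R i) ->
    (forall i, m i = (p == i) + degree N1 i) ->
  [\/ exists2 R', edges R' &
        forall i, m i = (p == i) + (x == i) + (y == i) + degree R' i,
      exposable m y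
    | exists2 R', edges R' &
        forall i, m i = (v == i) + (p == i) + (y == i) + degree R' i].
Proof.
move=> eR eN1 exy.
elim: {N1}(size N1).+1 {-2}N1 (ltnSn (size N1)) eN1 m v R eR
  => // k IH N1 sN1 eN1 m v R eR mR mN1.
case: (eqVneq v p) => [vp|nvp].
  by constructor 1; exists R => // i; rewrite -vp.
have [|w [N2 [evw eN2 sN2 dN2]]] := @take_edge N1 v eN1.
  by have := mR v; rewrite mN1 eqxx (eq_sym p) (negbTE nvp); count_lia.
have C i : (x == i) + (y == i) + degree R i
           = (p == i) + (w == i) + degree N2 i.
  by have := mR i; rewrite mN1 dN2; count_lia.
case: (eqVneq x w) => [xw|nxw].
  constructor 2; exists ((v, w) :: R); first by rewrite edges_cons evw.
  by move=> i; rewrite degree_cons mR xw; count_lia.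
case: (eqVneq y w) => [yw|nyw].
  constructor 3; exists N2 => // i.
  by rewrite mR; have := C i; rewrite yw; count_lia.
have [|z [R' [ewz eR' _ dR']]] := @take_edge R w eR.
  by have := C w; rewrite (negbTE nxw) (negbTE nyw) eqxx; count_lia.
have [|||[R1 eR1 dR1]|E|[R1 eR1 dR1]] := IH N2 _ eN2
  (fun i => (z == i) + (x == i) + (y == i) + degree R' i) z R' eR' => //.
- by rewrite -ltnS -sN2.
- by move=> i; have := C i; rewrite dR'; count_lia.
- constructor 1; exists ((v, w) :: R1); first by rewrite edges_cons evw.
  move=> i; rewrite degree_cons mR dR'; have := dR1 i; count_lia.
- constructor 2; apply: exposable_edge E; first exact: evw.
  by move=> i; rewrite mR dR'; count_lia.
- constructor 3; exists ((w, z) :: R1); first by rewrite edges_cons ewz.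
  by move=> i; rewrite degree_cons mR dR'; have := dR1 i; count_lia.
Qed.

(** Gallai's lemma in the presence of vertices that are not exposable: if v and x
    are joined by a walk of exposable vertices, an edge xy of a factorization
    exposing v can be kept while the exposed vertex moves along the walk, unless y
    becomes exposed on the way, until the exposed vertex is a neighbor of x;
    exchanging the two edges at x then exposes y.  The walk has positive length but may be closed, since several
    copies of v may occur in m. *)
Lemma exposable_walk m v p s x y R : edges R -> e x y ->
    path e v (p :: s) -> last p s = x ->
    (forall w, w \in p :: s -> exposable m w) ->
    (forall i, m i = (v == i) + (x == i) + (y == i) + degree R i) ->
  exposable m y.
Proof.
move=> eR exy; elim: s p v R eR => [|q s IH] p v R eR /=.
  rewrite andbT => evp <- _ mR.
  exists ((v, p) :: R); first by rewrite edges_cons evp.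
  by move=> i; rewrite degree_cons mR; count_lia.
case/andP=> evp epq lx expo mR.
have [|N1 eN1 dN1] := expo p; first by rewrite inE eqxx.
have [[R1 eR1 dR1]|//|[R1 eR1 dR1]] :=
  alternating_exchange eR eN1 exy mR dN1.
  apply: (IH q p R1) => // w ws; apply: expo.
  by rewrite inE ws orbT.
exists ((v, p) :: R1); first by rewrite edges_cons evp.
by move=> i; rewrite degree_cons dR1; count_lia.
Qed.

(** The alternating walk l z w z' ... takes the edges zw, ... from N1 and the
    edges wz', ... from N.  Exchanging them along the walk and adding lz gives one
    more edge, at the cost of covering l once.  The walk can only stop at a vertex
    with room left: it does not meet l0, which would then be exposable, and a
    neighbor w of an exposed vertex is completable, so that u vanishes at w and N
    has to cover w. *)
Lemma reroute l0 l z m u N N1 : irreflexive e -> edges N -> edges N1 -> e l z ->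
    (forall i, m i = (z == i) + degree N i) ->
    (forall i, (l0 == i) + degree N1 i <= m i + u i) ->
    ~ exposable m l0 -> (forall i, completable m i -> u i = 0) ->
  exists N', [/\ edges N', size N' = (size N1).+1
    & forall i, (l0 == i) + degree N' i <= (l == i) + m i + u i].
Proof.
move=> e_irr.
elim: {N}(size N).+1 {-2}N (ltnSn (size N)) l z m N1
  => // k IH N sN l z m N1 eN eN1 elz mN bN1 nl0 u0.
have expz : exposable m z by exists N.
have nl0z : l0 != z by apply/eqP=> E; case: nl0; rewrite E.
case: (ltnP (degree N1 z) (m z + u z)) => [ltz|gez].
  exists ((l, z) :: N1); split=> //; first by rewrite edges_cons elz.
  move=> i; rewrite degree_cons; have := bN1 i; move: ltz.
  by case: (eqVneq z i) => [<-|_]; rewrite ?(negbTE nl0z); count_lia.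
have [|w [N2 [ezw eN2 sN2 dN2]]] := @take_edge N1 z eN1.
  by apply: leq_trans gez; rewrite mN eqxx; count_lia.
have uw : u w = 0 by apply: u0; apply: exposable_completable expz.
have nzw : z != w by apply/eqP=> E; move: ezw; rewrite E e_irr.
have [|z' [N' [ewz' eN' sN' dN']]] := @take_edge N w eN.
  have := bN1 w; rewrite uw addn0 mN dN2 eqxx (negbTE nzw); count_lia.
have mE i : m i = (z == i) + (w == i) + ((z' == i) + degree N' i).
  by rewrite mN dN'; count_lia.
have [|||||N3 [eN3 sN3 dN3]] := IH N' _ w z' (fun i => (z' == i) + degree N' i)
  N2 eN' eN2 ewz' => //.
- by rewrite -ltnS -sN'.
- by move=> i; have := bN1 i; rewrite dN2 mE; count_lia.
- by move=> E; apply: nl0; apply: exposable_edge E; [exact: ezw|].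
- by move=> i E; apply: u0; apply: completable_edge E; [exact: ezw|].
exists ((l, z) :: N3); split; first by rewrite edges_cons elz.
  by rewrite /= sN3 sN2.
by move=> i; rewrite degree_cons; have := dN3 i; rewrite mE; count_lia.
Qed.

End Edges.

(** * Completing a vector over a vertex cover, gluing, and even walks *)

Section Glue.
Variables (T : finType) (e : rel T).
Hypothesis e_sym : symmetric e.
Implicit Types (N R : seq (T * T)) (m u : T -> nat).

(** If m u lies in I^t, some excess vertex v of the edge list is used more often
    than in m.  When v is not completable, the edge vl at v has l completable, as
    the completable vertices form a cover, and [reroute] replaces this edge so
    that the excess at v drops by one.  Induction on u finally leaves an edge list
    too large for m alone. *)
Lemma completable_cover m u t N1 : irreflexive e ->
    (forall x y, e x y -> completable e m x \/ completable e m y) ->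
    (\sum_i m i).+1 = t.*2 ->
    edges e N1 -> size N1 = t -> (forall i, degree N1 i <= m i + u i) ->
  exists2 i, 0 < u i & completable e m i.
Proof.
move=> e_irr cov sm.
elim: {u}(\sum_i u i).+1 {-2}u (ltnSn (\sum_i u i)) N1
  => // k IH u su N1 eN1 sN1 bN1.
apply: NNPP => none.
have u0 i : completable e m i -> u i = 0.
  move=> ci; case: (posnP (u i)) => // ui; case: none; by exists i.
have [v mv] : exists v, m v < degree N1 v.
  apply/existsP; rewrite -[[exists _, _]]negbK negb_exists; apply/negP.
  move=> /forallP le; have : (size N1).*2 <= \sum_i m i.
    by rewrite -sum_degree; apply: leq_sum => i _; rewrite leqNgt.
  by rewrite sN1 -sm ltnn.
have uv : 0 < u v by have := bN1 v; move: mv; count_lia.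
have nv : ~ completable e m v by move=> /u0; move: uv; count_lia.
have [|l [N2 [evl eN2 sN2 dN2]]] := @take_edge T e e_sym N1 v eN1.
  by move: mv; count_lia.
have [Nl eNl dNl] : completable e m l by case: (cov _ _ evl) => // /nv.
have [|z [N [elz eN _ dN]]] := @take_edge T e e_sym Nl l eNl.
  by rewrite -dNl eqxx; count_lia.
pose u' i := u i - (v == i).
have [|||i ci|N' [eN' sN' dN']] :=
  @reroute T e e_sym l l z m u' N N2 e_irr eN eN2 elz.
- by move=> i; have := dNl i; rewrite dN; count_lia.
- move=> i; have := bN1 i; rewrite dN2 /u'.
  by case: (eqVneq v i) => [<-|_]; move: uv; count_lia.
- by move=> xl; apply: nv; apply: exposable_completable xl; rewrite e_sym.
- by rewrite /u' u0.
have [|||i ui ci] := IH u' _ N' eN'.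
- have us i : u i = (v == i) + u' i.
    by rewrite /u'; case: (eqVneq v i) => [<-|_]; move: uv; count_lia.
  move: su; rewrite (eq_bigr _ (fun i _ => us i)) big_split /= sum_eq1; count_lia.
- by rewrite sN' -sN1 sN2.
- by move=> i; have := dN' i; count_lia.
by apply: none; exists i => //; move: ui; rewrite /u'; count_lia.
Qed.

(** The link w can be matched into either of the two parts, on the side where
    nothing is exposed. *)
Lemma glue m b m' s w d : exposable e m s -> e s w -> e w d ->
    exposable e b d -> (forall i, m' i = m i + (w == i) + b i) ->
  forall v, exposable e m v \/ exposable e b v -> exposable e m' v.
Proof.
move=> [Ns eNs dNs] esw ewd [Nd eNd dNd] mE v [[N eN dN]|[N eN dN]].
  exists ((w, d) :: N ++ Nd); first by rewrite edges_cons ewd edges_cat eN.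
  by move=> i; rewrite degree_cons degree_cat mE dN dNd; count_lia.
exists ((s, w) :: Ns ++ N); first by rewrite edges_cons esw edges_cat eNs.
by move=> i; rewrite degree_cons degree_cat mE dN dNs; count_lia.
Qed.

Definition two_steps : rel T := fun x y => [exists w, e x w && e w y].

Lemma exposable_path m x p : path two_steps x p -> exposable e m x ->
  exists m', (forall v, exposable e m v -> exposable e m' v) /\
    exposable e m' (last x p).
Proof.
elim: p x m => [|y p IH] x m /=; first by exists m.
case/andP=> /existsP[w /andP[exw ewy]] yp xm.
pose m' i := m i + (w == i) + (y == i).
have yy : exposable e (fun i => y == i) y.
  by exists [::] => // i; rewrite degree_nil addn0.
have G := glue xm exw ewy yy (fun i => erefl (m' i)).
have [|m2 [E L]] := IH y m' yp; first by apply: G; right.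
by exists m2; split=> // v vm; apply/E/G; left.
Qed.

(** Even walks from x0 are appended one after the other: two further steps
    s, w, d move the exposed vertex from s to d, when w is matched to s instead of
    d. *)
Lemma even_spread x0 : exists m,
  forall v, connect two_steps x0 v -> exposable e m v.
Proof.
suff [m [_ mE]] : exists m, exposable e m x0 /\
    forall v, v \in [seq v <- enum T | connect two_steps x0 v] ->
      exposable e m v.
  by exists m => v cv; apply: mE; rewrite mem_filter cv mem_enum.
elim: (enum T) => [|v s [m [xm mE]]] /=.
  exists (fun i => x0 == i); split=> //.
  by exists [::] => // i; rewrite degree_nil addn0.
case: ifP => [/connectP[p xp ->]|_]; last by exists m.
have [m' [E L]] := exposable_path xp xm.
exists m'; split=> [|w]; first exact: E.
by rewrite inE => /predU1P[->|/mE/E].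
Qed.

(** Makes the halving in the definition of mu-star exact. *)
Lemma exposable_odd m v : exposable e m v ->
  exists t, \sum_i m i = t.*2.+1.
Proof.
move=> [N eN dN]; exists (size N).
by rewrite (eq_bigr _ (fun i _ => dN i)) big_split /= sum_eq1 sum_degree.
Qed.

Lemma two_steps_sym : symmetric two_steps.
Proof.
move=> x y; apply/existsP/existsP => -[w /andP[a b]]; exists w;
  by rewrite e_sym b e_sym.
Qed.

Lemma two_steps_shift x y a b : e x a -> e y b ->
  connect two_steps x y -> connect two_steps a b.
Proof.
move=> exa eyb cxy; case/connectP: cxy eyb => p; elim: p x a exa => [|z p IH] x a exa /=.
  move=> _ -> exb; apply: connect1; apply/existsP; exists x.
  by rewrite e_sym exa.
case/andP=> /existsP[w /andP[exw ewz]] zp yE eyb.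
have czb : connect two_steps w b by apply: (IH z w) => //; rewrite e_sym.
apply: connect_trans czb; apply: connect1; apply/existsP; exists x.
by rewrite e_sym exa.
Qed.

Lemma even_or_odd x0 : connected e -> forall x,
  connect two_steps x0 x \/ exists2 y, connect two_steps x0 y & e y x.
Proof.
move=> /forallP/(_ x0)/forallP cx x.
case/connectP: (cx x) => p; elim/last_ind: p x => [|p y IH] x /=.
  by move=> _ ->; left.
rewrite rcons_path last_rcons => /andP[xp ey] ->.
case: (IH _ xp erefl) => [ce|[z cz ez]]; first by right; exists (last x0 p).
left; apply: connect_trans cz _; apply: connect1; apply/existsP.
by exists (last x0 p); rewrite ez.
Qed.

(** The vertices A at even walk distance from x0 always have an independent
    complement, so in a non-bipartite graph two of them are adjacent, which makes
    even walks odd and conversely. *)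
Lemma nonbipartite_even x0 : connected e -> ~~ bipartite e ->
  forall x, connect two_steps x0 x.
Proof.
move=> e_conn nb.
pose A := [set x | connect two_steps x0 x].
have tsym : connect_sym two_steps by apply/sym_connect_sym/two_steps_sym.
have nA x : x \notin A -> exists2 y, connect two_steps x0 y & e y x.
  by rewrite inE; case: (even_or_odd x0 e_conn x) => [->|].
have iA' : independent e (~: A).
  apply/forallP=> x; apply/implyP; rewrite inE => xA.
  apply/forallP=> y; apply/implyP; rewrite inE => yA; apply/negP => exy.
  have [z cz ezx] := nA x xA; case/negP: yA; rewrite inE.
  apply: connect_trans cz _; apply: connect1; apply/existsP; exists x.
  by rewrite ezx.
have [x [y [xA yA exy]]] : exists x y, [/\ x \in A, y \in A & e x y].
  apply: NNPP => none; case/negP: nb; apply/existsP; exists A.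
  rewrite iA' andbT; apply/forallP=> x; apply/implyP => xA.
  apply/forallP=> y; apply/implyP => yA; apply/negP => exy.
  by apply: none; exists x, y.
rewrite !inE in xA yA.
move=> z; case: (even_or_odd x0 e_conn z) => // -[w cw ewz].
apply: connect_trans yA _; apply: (two_steps_shift exy ewz).
by apply: connect_trans cw; rewrite tsym.
Qed.

End Glue.

(** * Minima of sets of numbers *)

Lemma min_of_eq A m : is_min A m -> min_of A = m.
Proof.
move=> mA; have mE : is_min A (min_of A) by apply: epsilon_spec; exists m.
by apply/eqP; rewrite eqn_leq mA.2 ?mE.2 //; [case: mA | case: mE].
Qed.

Lemma min_ofP (A : nat -> Prop) l : A l -> is_min A (min_of A).
Proof.
move=> Al; suff [m mA] : exists m, is_min A m by rewrite (min_of_eq mA).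
elim/ltn_ind: l Al => l IH Al.
have [[l' [lt Al']]|none] := classic (exists l', l' < l /\ A l').
  exact: IH Al'.
exists l; split=> // l' Al'; rewrite leqNgt; apply/negP => lt.
by apply: none; exists l'.
Qed.

(** * Parallelizations and their perfect matchings *)

Section PerfectMatching.
Variables (T X : finType) (e : rel T) (pi : X -> T).
Hypothesis e_irr : irreflexive e.

Let g : rel X := fun x y => e (pi x) (pi y).

Lemma sum_pair (x y : X) (F : X -> nat) :
  x != y -> \sum_(z in [set x; y]) F z = F x + F y.
Proof. by move=> nxy; rewrite big_setU1 ?inE //= big_set1. Qed.

Lemma degree_of_matching (M : {set {set X}}) (S : {set X}) :
    M \subset edge_set g -> partition M S ->
  exists2 N, edges e N & forall i, \sum_(x in S) (pi x == i) = degree N i.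
Proof.
move=> /subsetP sM pM.
pose pick2 (B : {set X}) : seq (T * T) :=
  if [pick p : X * X | g p.1 p.2 && (B == [set p.1; p.2])] is Some p
  then [:: (pi p.1, pi p.2)] else [::].
have pickE B : B \in M -> edges e (pick2 B) /\
    forall i, \sum_(x in B) (pi x == i) = degree (pick2 B) i.
  move=> /sM; rewrite inE => /existsP[x /existsP[y /andP[gxy /eqP BE]]].
  rewrite /pick2; case: pickP => [[u v] /= /andP[guv /eqP->]|/(_ (x, y))].
    split=> [|i]; first by rewrite andbT.
    rewrite (sum_pair (fun z => pi z == i : nat)) ?degree_cons ?degree_nil ?addn0 //.
    by apply/eqP=> E; move: guv; rewrite /g E e_irr.
  by rewrite /= gxy BE eqxx.
have H (s : seq {set X}) : {subset s <= M} ->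
    edges e (flatten (map pick2 s)) /\ forall i,
    \sum_(B <- s) \sum_(x in B) (pi x == i) = degree (flatten (map pick2 s)) i.
  elim: s => [|B s IH] sB /=.
    by split=> // i; rewrite big_nil degree_nil.
  have [|eN dN] := IH; first by move=> C Cs; apply: sB; rewrite inE Cs orbT.
  have [|eB dB] := pickE B; first by apply: sB; rewrite inE eqxx.
  split=> [|i]; first by rewrite edges_cat eB.
  by rewrite big_cons degree_cat dB dN.
have [|eN dN] := H (enum M); first by move=> B; rewrite mem_enum.
exists (flatten (map pick2 (enum M))) => // i.
by rewrite -dN (set_partition_big _ pM) big_enum.
Qed.

(** The vertices of X are copies, pi x being the vertex copied.  Edges of N are
    realized one at a time by any two copies not used so far. *)
Lemma matching_of_degree N (S : {set X}) : edges e N ->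
    (forall i, \sum_(x in S) (pi x == i) = degree N i) ->
  exists2 M : {set {set X}}, M \subset edge_set g & partition M S.
Proof.
elim: N S => [|[a b] N IH] S.
  move=> _ dN; exists set0; first exact: sub0set.
  suff -> : S = set0 by rewrite partition_set0.
  apply/setP=> x; rewrite inE; apply/negP => xS.
  by have := dN (pi x); rewrite (bigD1 x) //= degree_nil eqxx.
rewrite edges_cons => /andP[eab eN] dN.
have nab : a != b by apply/eqP=> E; move: eab; rewrite E e_irr.
have pickS i (A : {set X}) : 0 < \sum_(x in A) (pi x == i) ->
    exists2 x, x \in A & pi x = i.
  rewrite lt0n sum_nat_eq0 negb_forall => /existsP[x].
  by rewrite negb_imply eqb0 negbK => /andP[xA /eqP]; exists x.
have [|x xS xa] := pickS a S; first by rewrite dN degree_cons eqxx; count_lia.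
have [|y yS yb] := pickS b S; first by rewrite dN degree_cons eqxx; count_lia.
have nxy : x != y by apply: contra_neq nab => E; rewrite -xa -yb E.
pose S' := S :\: [set x; y].
have sxy : [set x; y] \subset S by rewrite subUset !sub1set xS.
have [|M sM pM] := IH S' eN.
  move=> i; have := dN i; rewrite (big_setID [set x; y]) /= (setIidPr sxy).
  rewrite (sum_pair (fun z => pi z == i : nat)) // degree_cons xa yb -/S'.
  by move: (\sum_(_ in S') _) => ?; count_lia.
exists ([set x; y] |: M).
  rewrite subUset sub1set sM andbT inE; apply/existsP; exists x.
  by apply/existsP; exists y; rewrite eqxx /g xa yb eab.
have -> : S = [set x; y] :|: S' by rewrite -[LHS](setID S [set x; y]) (setIidPr sxy).
apply: partitionU1 pM _ _; first by apply/set0Pn; exists x; rewrite !inE eqxx.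
by rewrite disjoint_sym disjoints_subset /S' setDE subsetIr.
Qed.

End PerfectMatching.

Section Parallelization.
Variables (T : finType) (e : rel T).
Hypothesis e_irr : irreflexive e.
Implicit Types (a : T -> nat).

Lemma sum_copies a i : \sum_(x : {i : T & 'I_(a i)}) (tag x == i) = a i.
Proof.
rewrite (eq_bigl (fun x : {i : T & 'I_(a i)} =>
  xpredT (tag x) && xpredT (tagged x))) //.
rewrite -(sig_big_dep xpredT (fun i => xpredT)
  (fun j (_ : 'I_(a j)) => (j == i : nat))).
rewrite (bigD1 i) //= [X in _ + X]big1 => [|j /negbTE nji].
  by rewrite eqxx sum_nat_const card_ord muln1 addn0.
by rewrite big1 // => ? _; rewrite nji.
Qed.

Lemma sum_copies_but a (v : {i : T & 'I_(a i)}) i :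
  a i = (tag v == i) +
    \sum_(x : {x | x \in [set~ v]}) (tag (val x) == i).
Proof.
rewrite -{1}(sum_copies a i) (bigD1 v) //=; congr (_ + _).
rewrite -(big_sub (mem [set~ v]) (fun x => (tag x == i : nat))).
by apply: eq_bigl => x; rewrite !inE.
Qed.

Lemma factor_critical_exposable a : (forall i, 0 < a i) ->
  factor_critical (parallelization e a) -> forall v, exposable e a v.
Proof.
move=> a0 /andP[_ /forallP pm] v.
pose w : {i : T & 'I_(a i)} := Tagged (fun i => 'I_(a i)) (Ordinal (a0 v)).
have /existsP[M /andP[sM pM]] := pm w.
have [N eN dN] := @degree_of_matching T _ e (fun x => tag (val x)) e_irr M _ sM pM.
exists N => // i; rewrite (sum_copies_but w) -dN; congr (_ + _).
by apply: eq_bigl => x; rewrite inE.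
Qed.

(** With all multiplicities positive, connectedness passes from the graph to its
    parallelization; two copies of one vertex are joined through a neighbor, which
    is where the existence of an edge matters. *)
Lemma exposable_factor_critical a : symmetric e -> connected e ->
    (exists x y, e x y) -> (forall v, exposable e a v) ->
  factor_critical (parallelization e a).
Proof.
move=> e_sym /forallP e_conn [x0 [y0 exy0]] expo.
have a0 i : 0 < a i by have [N _ ->] := expo i; rewrite eqxx.
have nbr i : exists j, e i j.
  have [->|ni] := eqVneq i x0; first by exists y0.
  have /forallP/(_ x0)/connectP[[|j p] /=] := e_conn i.
    by move=> _ E; rewrite E eqxx in ni.
  by case/andP=> eij _ _; exists j.
have conn x i (j : 'I_(a i)) :
    connect (parallelization e a) x (Tagged (fun i => 'I_(a i)) j).
  pose Q i := forall j : 'I_(a i),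
    connect (parallelization e a) x (Tagged (fun i => 'I_(a i)) j).
  have [k exk] := nbr (tag x).
  have Qk : Q k by move=> l; apply: connect1.
  suff: Q i by apply.
  have /forallP/(_ i)/connectP[p] := e_conn k.
  elim: p k Qk {exk} => [|l p IH] k Qk /=; first by move=> _ ->.
  case/andP=> ekl lp iE; apply: (IH l) => // j'.
  by apply: connect_trans (Qk (Ordinal (a0 k))) _; apply: connect1.
apply/andP; split.
  by apply/forallP=> x; apply/forallP=> -[i j]; apply: conn.
apply/forallP=> v; apply/existsP.
have [N eN dN] := expo (tag v).
have [|M sM pM] := @matching_of_degree T _ e
  (fun x : {x | x \in [set~ v]} => tag (val x)) e_irr N [set: _] eN.
  move=> i; have := dN i; rewrite (sum_copies_but v) => /addnI <-.
  by apply: eq_bigl => x; rewrite inE.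
by exists M; rewrite sM.
Qed.

Lemma mu_star_conn_le a : symmetric e -> connected e ->
    (exists x y, e x y) -> (forall v, exposable e a v) ->
  (mu_star_conn e).*2.+1 <= \sum_i a i.
Proof.
move=> e_sym e_conn e_edge expo; have [v _] := e_edge.
have [t st] := exposable_odd (expo v).
rewrite st ltnS leq_double.
have At : exists a : T -> nat,
    [/\ forall i, 0 < a i, factor_critical (parallelization e a)
      & t = ((\sum_i a i).-1)./2].
  exists a; split.
  - by move=> i; have [N _ ->] := expo i; rewrite eqxx.
  - exact: exposable_factor_critical.
  - by rewrite st /= doubleK.
exact: (min_ofP At).2 At.
Qed.

(** The set minimized in mu-star is not empty: in a connected non-bipartite graph
    all vertices are joined by even walks, so [even_spread] exposes every vertex,
    in particular with positive multiplicities. *)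
Lemma mu_star_conn_attained : symmetric e -> connected e -> ~~ bipartite e ->
  exists2 a, forall v, exposable e a v & \sum_i a i = (mu_star_conn e).*2.+1.
Proof.
move=> e_sym e_conn nb.
have [x0 [y0 exy0]] : exists x y, e x y.
  apply: NNPP => none; case/negP: nb; apply/existsP; exists [set: T].
  apply/andP; split; apply/forallP=> x; apply/implyP => _;
    apply/forallP=> y; apply/implyP => _; apply/negP => exy;
    by apply: none; exists x, y.
have [m mE] := @even_spread T e x0.
have expo v : exposable e m v by apply/mE/nonbipartite_even.
have m0 i : 0 < m i by have [N _ ->] := expo i; rewrite eqxx.
have [|[a [a0 fc muE]] _] := @min_ofP (fun t => exists a : T -> nat,
    [/\ forall i, 0 < a i, factor_critical (parallelization e a)
      & t = ((\sum_i a i).-1)./2]) ((\sum_i m i).-1)./2.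
  exists m; split=> //; apply: exposable_factor_critical => //.
  by exists x0, y0.
have ea := factor_critical_exposable a0 fc.
exists a => //; rewrite /mu_star_conn muE.
by have [t ->] := exposable_odd (ea x0); rewrite /= doubleK.
Qed.

End Parallelization.

(** * Induced subgraphs, components and the blocks of a pair *)

Section Induced.
Variable T : finType.
Implicit Types (r e : rel T) (W : {set T}).

Lemma connect_inducedP r W (x y : {x | x \in W}) :
  reflect (exists s,
      [/\ path r (val x) s, last (val x) s = val y & all (mem W) s])
    (connect (induced r W) x y).
Proof.
apply: (iffP connectP) => [[p xp ->]|[s [xs ls aW]]].
  exists (map val p); split; last 1 first.
  - by apply/allP=> _ /mapP[z _ ->]; apply: valP.
  - by rewrite path_map.
  - by rewrite last_map.
elim: s x xs ls aW => [|z s IH] x /=; first by move=> _ /val_inj -> _; exists [::].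
case/andP=> xz zs ls /andP[zW sW].
have [p xp yE] := IH (exist _ z zW) zs ls sW.
by exists (exist _ z zW :: p) => //=; rewrite xp andbT.
Qed.

Lemma induced_sym r W : symmetric r -> symmetric (induced r W).
Proof. by move=> rs x y; apply: rs. Qed.

Lemma induced_irr r W : irreflexive r -> irreflexive (induced r W).
Proof. by move=> ri x; apply: ri. Qed.

Lemma componentP e (C : {set T}) :
  reflect (exists x, C = [set y | connect e x y]) (C \in components e).
Proof.
apply: (iffP imsetP) => [[x _ ->]|[x ->]].
  by exists x; apply/setP=> y; rewrite !inE.
by exists x => //; apply/setP=> y; rewrite !inE.
Qed.

Lemma component_connect e (C : {set T}) x : symmetric e ->
  C \in components e -> x \in C -> forall y, (y \in C) = connect e x y.
Proof.
move=> es /componentP[z ->]; rewrite inE => zx y; rewrite inE.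
by apply: same_connect => //; apply: sym_connect_sym.
Qed.

Lemma component_connected e (C : {set T}) : symmetric e ->
  C \in components e -> connected (induced e C).
Proof.
move=> es Cc; apply/forallP=> x; apply/forallP=> y; apply/connect_inducedP.
have : connect e (val x) (val y).
  by rewrite -(component_connect es Cc (valP x)) (valP y).
case/connectP=> p xp yE; exists p; split=> //.
apply/allP=> z zp; rewrite inE (component_connect es Cc (valP x)).
by apply: (path_connect xp); rewrite in_cons zp orbT.
Qed.

End Induced.

Section Transfer.
Variables (T' T : finType) (e' : rel T') (e : rel T) (f : T' -> T).
Hypothesis f_inj : injective f.
Hypothesis eE : forall x y, e' x y = e (f x) (f y).

Lemma degree_map (N : seq (T' * T')) i :
  degree [seq (f p.1, f p.2) | p <- N] (f i) = degree N i.
Proof. by rewrite /degree big_map; under eq_bigr do rewrite !(inj_eq f_inj). Qed.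

Lemma degree_map0 (N : seq (T' * T')) j : (forall i, f i != j) ->
  degree [seq (f p.1, f p.2) | p <- N] j = 0.
Proof.
move=> nj; rewrite /degree big_map big1 // => p _.
by rewrite (negbTE (nj _)) (negbTE (nj _)).
Qed.

Lemma exposable_push a b v : exposable e' a v ->
    (forall i, b (f i) = a i) -> (forall j, (forall i, f i != j) -> b j = 0) ->
  exposable e b (f v).
Proof.
move=> [N eN dN] bE b0; exists [seq (f p.1, f p.2) | p <- N].
  by rewrite /edges all_map; under eq_all do rewrite /= -eE.
move=> j; have [i /eqP <-|none] := pickP (fun i => f i == j).
  by rewrite bE dN degree_map (inj_eq f_inj).
have nj i : f i != j by rewrite none.
by rewrite b0 // degree_map0 // (negbTE (nj v)).
Qed.

(** Edge lists live on the ambient vertices; this brings those inside the image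
    of f back to the smaller graph. *)
Lemma edges_pull N : edges e N ->
    (forall p, p \in N -> (exists i, f i = p.1) /\ (exists j, f j = p.2)) ->
  exists2 N', edges e' N' & forall i, degree N' i = degree N (f i).
Proof.
elim: N => [_ _|[x y] N IH]; first by exists [::] => // i; rewrite !degree_nil.
rewrite edges_cons => /andP[exy eN] im.
have [|N' eN' dN'] := IH eN.
  by move=> p pN; apply: im; rewrite inE pN orbT.
have [[i iE] [j jE]] := im (x, y) (mem_head _ _); rewrite /= in iE jE.
exists ((i, j) :: N'); first by rewrite edges_cons eE iE jE exy.
by move=> l; rewrite !degree_cons -iE -jE !(inj_eq f_inj) dN'.
Qed.

Lemma extend_exposable a :
  exists2 b : T -> nat, \sum_i b i = \sum_i a i &
    forall v, exposable e' a v -> exposable e b (f v).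
Proof.
exists (fun x => \sum_i (f i == x) * a i).
  rewrite exchange_big /=; apply: eq_bigr => i _.
  by rewrite -big_distrl /= sum_eq1 mul1n.
move=> v va; apply: (exposable_push va) => [i|j nj].
  rewrite (bigD1 i) //= eqxx mul1n big1 ?addn0 // => i' /negbTE ni.
  by rewrite (inj_eq f_inj) ni.
by rewrite big1 // => i _; rewrite (negbTE (nj i)).
Qed.

End Transfer.

Section Blocks.
Variables (T : finType) (e : rel T) (U V : {set T}).
Hypothesis e_sym : symmetric e.
Hypothesis V_indep : independent e V.
Hypothesis UV : neighbors e U :&: V = set0.
Hypothesis U_nbr : forall x, x \in U -> exists2 y, y \in U & e x y.

(** The connected components of the graph induced on the union of U and V, each
    with its contribution to lambda minus one.  A list treats the components of
    G[U] and the single vertices of V alike. *)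
Definition blocks : seq ({set T} * nat) :=
  [seq (val @: (C : {set {x | x \in U}}), mu_star_conn (induced (induced e U) C))
    | C <- enum (components (induced e U))]
  ++ [seq ([set v], 0) | v <- enum V].

Lemma sum_blocks : \sum_(B <- blocks) B.2.+1 = lambda e U V.
Proof.
rewrite big_cat /= !big_map /lambda /mu_star big_enum /= big_enum /= sum1_card.
congr (_ + _).
under eq_bigr do rewrite -addn1.
by rewrite big_split /= sum1_card.
Qed.

Lemma mem_blocks x :
  reflect (exists2 B, B \in blocks & x \in B.1) (x \in U :|: V).
Proof.
apply: (iffP setUP) => [[xU|xV]|[B]].
- pose x' : {x | x \in U} := exist _ x xU.
  pose C := [set y | connect (induced e U) x' y].
  exists (val @: C, mu_star_conn (induced (induced e U) C)).
    rewrite mem_cat; apply/orP; left; apply/mapP; exists C => //.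
    by rewrite mem_enum; apply/componentP; exists x'.
  by apply/imsetP; exists x' => //; rewrite inE.
- exists ([set x], 0); last by rewrite inE.
  by rewrite mem_cat; apply/orP; right; apply/mapP; exists x; rewrite // mem_enum.
rewrite mem_cat => /orP[/mapP[C _ ->] /imsetP[y _ ->]|/mapP[v vV -> /=]].
  by left; apply: valP.
by rewrite inE => /eqP ->; right; move: vV; rewrite mem_enum.
Qed.

Definition separated : rel ({set T} * nat) := fun B B' =>
  [forall x in B.1, forall y in B'.1, (x != y) && ~~ e x y].

Lemma separatedP (B B' : {set T} * nat) :
  reflect (forall x y, x \in B.1 -> y \in B'.1 -> x != y /\ ~~ e x y)
    (separated B B').
Proof.
apply: (iffP forall_inP) => [H x y xB yB|H x xB].
  by have /forall_inP/(_ y yB)/andP := H x xB.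
by apply/forall_inP=> y yB; apply/andP/H.
Qed.

Lemma separated_sym : symmetric separated.
Proof.
by move=> B B'; apply/separatedP/separatedP => H x y xB yB;
  rewrite eq_sym e_sym; apply: H.
Qed.

Lemma blocks_separated : pairwise separated blocks.
Proof.
have es' : symmetric (induced e U) by apply: induced_sym.
rewrite pairwise_cat !pairwise_map; apply/and3P; split.
- apply/allrelP=> _ _ /mapP[C _ ->] /mapP[v vV ->].
  rewrite mem_enum in vV; apply/separatedP=> x y /= /imsetP[x' _ ->].
  rewrite inE => /eqP ->.
  have nN : v \notin neighbors e U.
    by apply/negP=> vN; move/setP/(_ v): UV; rewrite in_setI vN vV in_set0.
  have nv z : z \in U -> ~~ e z v.
    move=> zU; apply: contra nN => ezv; rewrite inE; apply/existsP; exists z.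
    by rewrite zU.
  split; last exact: nv (valP x').
  apply: contraNneq nN => <-; have [z zU ez] := U_nbr (valP x').
  by rewrite inE; apply/existsP; exists z; rewrite zU e_sym.
- have := enum_uniq (components (induced e U)); rewrite uniq_pairwise.
  apply: (sub_in_pairwise (P := [in components (induced e U)])) => [C C'|]; last first.
    by apply/allP=> C; rewrite mem_enum.
  move=> Cc Cc' nC; apply/separatedP => _ _ /imsetP[x xC ->] /imsetP[y yC' ->].
  have nxy : ~~ connect (induced e U) x y.
    apply: contra nC => cxy; apply/eqP/setP=> z.
    have yC : y \in C by rewrite (component_connect es' Cc xC).
    by rewrite (component_connect es' Cc yC) (component_connect es' Cc' yC').
  split; first by apply: contraNneq nxy => /val_inj ->.
  by apply: contra nxy => exy; apply: connect1.
- have := enum_uniq V; rewrite uniq_pairwise.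
  apply: (sub_in_pairwise (P := [in V])) => [v w|]; last first.
    by apply/allP=> v; rewrite mem_enum.
  move=> vV wV nvw; apply/separatedP => x y /= /set1P-> /set1P->; split=> //.
  by have /forall_inP/(_ v vV)/forall_inP/(_ w wV) := V_indep.
Qed.

Definition touch (N : seq (T * T)) (B : {set T}) : nat :=
  count (fun p => (p.1 \in B) || (p.2 \in B)) N.

(** An edge cannot meet two blocks, which are disjoint and not adjacent. *)
Lemma touch_blocks N (s : seq ({set T} * nat)) : pairwise separated s ->
  edges e N -> \sum_(B <- s) touch N B.1 <= size N.
Proof.
move=> sep; elim: N => [_|[x y] N IH]; first by rewrite big1.
rewrite edges_cons => /andP[exy eN] /=.
have -> : \sum_(B <- s) touch ((x, y) :: N) B.1 =
    \sum_(B <- s) ((x \in B.1) || (y \in B.1)) + \sum_(B <- s) touch N B.1.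
  by rewrite -big_split.
rewrite -[X in _ <= X]add1n; apply: leq_add; last exact: IH.
elim: s sep {IH} => [|B s IH] /=; first by rewrite big_nil.
case/andP=> /allP sB /IH {}IH; rewrite big_cons.
case: (boolP ((x \in B.1) || _)) => [tB|_]; last by rewrite add0n.
rewrite big_seq big1 ?addn0 // => B' /sB /separatedP sBB'.
apply/eqP; rewrite eqb0; apply/negP => tB'.
case/orP: tB => [xB|yB]; case/orP: tB' => [xB'|yB'].
- by have [/eqP] := sBB' _ _ xB xB'.
- by have [_ /negP] := sBB' _ _ xB yB'.
- by have [_ /negP] := sBB' _ _ yB xB'; rewrite e_sym.
- by have [/eqP] := sBB' _ _ yB yB'.
Qed.

Lemma touch_degree N (B : {set T}) : \sum_(i in B) degree N i <= (touch N B).*2.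
Proof.
elim: N => [|[x y] N IH].
  by rewrite big1 // => i _; rewrite degree_nil.
under eq_bigr do rewrite degree_cons.
rewrite big_split /= big_split /= /touch /= doubleD.
apply: leq_add IH.
by rewrite !sum_in1; case: (x \in B); case: (y \in B).
Qed.

End Blocks.

(** * Exposable vertices and factor-critical components *)

Section Bipartite.
Variables (T : finType) (e : rel T).

Lemma degree_side (A : {set T}) N : independent e A -> independent e (~: A) ->
  edges e N -> \sum_(i in A) degree N i = size N.
Proof.
move=> iA iA'; elim: N => [_|[x y] N IH].
  by rewrite big1 // => i _; rewrite degree_nil.
rewrite edges_cons => /andP[exy /IH {}IH].
under eq_bigr do rewrite degree_cons.
rewrite big_split /= big_split /= IH !sum_in1.
have nA : ~~ ((x \in A) && (y \in A)).
  apply/negP=> /andP[xA yA].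
  by have /forall_inP/(_ x xA)/forall_inP/(_ y yA)/negP := iA.
have nA' : (x \in A) || (y \in A).
  rewrite -[_ || _]negbK negb_or -!in_setC; apply/negP=> /andP[xA yA].
  by have /forall_inP/(_ x xA)/forall_inP/(_ y yA)/negP := iA'.
by case: (x \in A) nA nA'; case: (y \in A).
Qed.

(** Exposing a vertex on one side of a bipartition shows that side to be larger by
    one than the other, for each of the two sides. *)
Lemma exposable_nonbipartite a : (exists x y, e x y) ->
  (forall v, exposable e a v) -> ~~ bipartite e.
Proof.
move=> [x [y exy]] expo; apply/negP => /existsP[A /andP[iA iA']].
have side (B : {set T}) v : independent e B -> independent e (~: B) -> v \in B ->
    \sum_(i in B) a i = (\sum_(i in ~: B) a i).+1.
  move=> iB iB' vB; have [N eN dN] := expo v.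
  rewrite !(eq_bigr _ (fun i _ => dN i)) !big_split /= !sum_in1 vB inE vB.
  by rewrite !degree_side ?setCK.
have [u uA] : exists u, u \in A.
  apply: NNPP => none; have nA z : z \in ~: A.
    by rewrite inE; apply/negP => zA; apply: none; exists z.
  by have /forall_inP/(_ x (nA x))/forall_inP/(_ y (nA y))/negP := iA'.
have [w wA] : exists w, w \in ~: A.
  apply: NNPP => none; have nA z : z \in A.
    by rewrite -[z \in A]negbK -in_setC; apply/negP => zA; apply: none; exists z.
  by have /forall_inP/(_ x (nA x))/forall_inP/(_ y (nA y))/negP := iA.
have := side _ _ iA iA' uA.
have := side (~: A) _ iA'; rewrite setCK => /(_ _ iA wA).
lia.
Qed.

End Bipartite.

Section Exposed.
Variables (T : finType) (e : rel T) (m : T -> nat) (U : {set T}).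
Hypothesis e_sym : symmetric e.
Hypothesis U_exp : forall x, x \in U -> exposable e m x.
Hypothesis U_nbr : forall x, x \in U -> exists2 y, y \in U & e x y.
Hypothesis U_closed : forall x y, x \in U -> e x y -> exposable e m y -> y \in U.

(** The vertices of a component are joined by walks of exposable vertices, so
    [exposable_walk] forbids edges leaving it. *)
Lemma component_closed (C : {set {x | x \in U}}) v N :
    C \in components (induced e U) -> v \in C -> edges e N ->
    (forall i, m i = (val v == i) + degree N i) ->
  forall p, p \in N -> (p.1 \in val @: C) = (p.2 \in val @: C).
Proof.
move=> Cc vC eN mN.
have es' : symmetric (induced e U) by apply: induced_sym.
have key x y R : e x y -> edges e R ->
    (forall i, m i = (val v == i) + (x == i) + (y == i) + degree R i) ->
    x \in val @: C -> y \in val @: C.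
  move=> exy eR mR /imsetP[x' x'C xE].
  have cvx : connect (induced e U) v x' by rewrite -(component_connect es' Cc vC).
  have yexp : exposable e m y.
    have /connect_inducedP[s [vs ls aU]] := cvx.
    case: s vs ls aU => [|p s] /= vs ls aU.
      have [u uU evu] := U_nbr (valP v).
      apply: (exposable_walk e_sym (p := u) (s := [:: val v]) eR exy _ _ _ mR).
      - by rewrite /= evu e_sym evu.
      - by rewrite /= ls xE.
      - by move=> w; rewrite !inE => /orP[]/eqP->; apply: U_exp => //; apply: valP.
    apply: (exposable_walk e_sym eR exy vs _ _ mR); first by rewrite ls xE.
    move=> w ws; apply: U_exp; move: aU; rewrite -/(all (mem U) (p :: s)).
  by move=> /allP/(_ w ws).
  have xU : x \in U by rewrite xE; apply: valP.
  have yU : y \in U by apply: U_closed exy yexp.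
  apply/imsetP; exists (exist _ y yU) => //.
  rewrite (component_connect es' Cc x'C); apply: connect1.
  by rewrite /induced /= -xE.
move=> [x y] pN /=; have exy : e x y by have /allP/(_ _ pN) := eN.
have mR i : m i = (val v == i) + (x == i) + (y == i) + degree (rem (x, y) N) i.
  by rewrite mN (degree_rem i pN) /=; count_lia.
apply/idP/idP; apply: key (edges_rem (x, y) eN) _ => //; first by rewrite e_sym.
by move=> i; rewrite mR; count_lia.
Qed.

(** Restricting a factorization that exposes v to the component of v loses
    nothing at the vertices of that component. *)
Lemma component_exposable (C : {set {x | x \in U}}) :
    C \in components (induced e U) -> forall v : {x | x \in C},
  exposable (induced (induced e U) C) (fun i => m (val (val i))) v.
Proof.
move=> Cc v; have vC := valP v.
have [N eN mN] := U_exp (valP (val v)).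
have cl := component_closed Cc vC eN mN.
pose K : {set T} := val @: C.
pose NK := [seq p <- N | p.1 \in K].
have vvI : injective (fun i : {x | x \in C} => val (val i)).
  by move=> i j /val_inj/val_inj.
have imK x : x \in K -> exists i : {x | x \in C}, val (val i) = x.
  by case/imsetP=> i iC ->; exists (exist _ i iC).
have eNK : edges e NK by apply/allP=> p; rewrite mem_filter => /andP[_ /(allP eN)].
have [|N' eN' dN'] := @edges_pull _ _ (induced (induced e U) C) e _ vvI
    (fun x y => erefl) NK eNK.
  move=> p; rewrite mem_filter => /andP[pK pN].
  by split; apply: imK => //; rewrite -cl.
exists N' => // i; rewrite dN' mN (inj_eq (inj_comp val_inj val_inj)); congr (_ + _).
have iK : val (val i) \in K by apply: imset_f; apply: valP.
rewrite /degree big_filter [RHS]big_mkcond /= !big_seq; apply: eq_bigr => p pN.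
case: ifP => // /negbT pK.
have p2K : p.2 \notin K by rewrite -cl.
case: eqP => [E|_]; first by rewrite E iK in pK.
by case: eqP => [E|_] //; rewrite E iK in p2K.
Qed.

End Exposed.

(** * From witnesses to admissible pairs *)

Section FromWitness.
Variables (T : finType) (e : rel T).
Hypothesis e_sym : symmetric e.
Hypothesis e_irr : irreflexive e.
Hypothesis e_edge : exists x y, e x y.

Definition covering (m : T -> nat) : Prop :=
  forall x y, e x y -> completable e m x \/ completable e m y.

(** Exponent vectors of degree 2t - 1, the least degree possible for a polynomial
    whose colon ideal in I^t is prime. *)
Definition short_witness (t : nat) : Prop :=
  exists2 m : T -> nat, (\sum_i m i).+1 = t.*2 & covering m.

Lemma square_two_steps x w y : e x w -> e w y -> x != y -> square e x y.
Proof.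
move=> exw ewy nxy; rewrite /square nxy /=; apply/existsP.
exists (Ordinal (isT : 2 < 3)); apply/existsP; exists [tuple w; y].
by rewrite /= exw ewy eqxx.
Qed.

Lemma square_inv x y : square e x y -> ~~ e x y -> exists2 w, e x w & e w y.
Proof.
case/andP=> nxy /existsP[[k k3] /existsP[[p /eqP sp] /=]].
have {}sp : size p = k by [].
case: p sp => [|a [|b [|c p]]] sp /=.
- by rewrite (negbTE nxy).
- by rewrite andbT => /andP[exa /eqP <-]; rewrite exa.
- by rewrite andbT -andbA => /and3P[exa eab /eqP <-] _; exists a.
- by move: k3; rewrite -sp.
Qed.

(** The outer vertices of an alternating walk from v to p are all exposable, and
    consecutive ones have a common neighbor. *)
Lemma exposable_linked m v p N N1 : edges e N -> edges e N1 ->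
    (forall i, m i = (v == i) + degree N i) ->
    (forall i, m i = (p == i) + degree N1 i) ->
  exists s, [/\ path (square e) v s, last v s = p
    & forall w, w \in s -> exposable e m w].
Proof.
elim: {N1}(size N1).+1 {-2}N1 (ltnSn (size N1)) N v m
  => // k IH N1 sN1 N v m eN eN1 mN mN1.
case: (eqVneq v p) => [vp|nvp]; first by exists [::].
have [|w [N2 [evw eN2 sN2 dN2]]] := @take_edge T e e_sym N1 v eN1.
  by have := mN v; rewrite mN1 eqxx (eq_sym p) (negbTE nvp); count_lia.
have C i : degree N i = (p == i) + (w == i) + degree N2 i.
  by have := mN i; rewrite mN1 dN2; count_lia.
have [|z [N' [ewz eN' _ dN']]] := @take_edge T e e_sym N w eN.
  by rewrite C eqxx; count_lia.
have mE i : m i = (v == i) + (w == i) + ((z == i) + degree N' i).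
  by rewrite mN dN'; count_lia.
have [|||s [zs ls es]] := IH N2 _ N' z (fun i => (z == i) + degree N' i) eN' eN2 => //.
- by rewrite -ltnS -sN2.
- by move=> i; have := C i; rewrite dN'; count_lia.
have es' u : u \in z :: s -> exposable e m u.
  rewrite inE => us; apply: (exposable_edge evw mE).
  by case/predU1P: us => [->|/es //]; exists N'.
case: (eqVneq v z) => [vz|nvz].
  exists s; rewrite vz; split=> // u us; apply: es'; by rewrite inE us orbT.
by exists (z :: s); split=> //=; rewrite (square_two_steps evw ewz).
Qed.

(** An isolated vertex would be a bipartite component. *)
Lemma nonbipartite_nbr (U : {set T}) :
    U = set0 \/ strongly_nonbipartite (induced e U) ->
  forall x, x \in U -> exists2 y, y \in U & e x y.
Proof.
move=> [->|snb] x xU; first by rewrite inE in xU.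
apply: NNPP => none.
pose x' : {x | x \in U} := exist _ x xU.
pose C := [set y | connect (induced e U) x' y].
have Cc : C \in components (induced e U) by apply/componentP; exists x'.
have /forall_inP/(_ C Cc)/negP := snb; apply.
have C1 (y : {y | y \in C}) : val y = x'.
  have := valP y; rewrite inE => /connectP[[|z p] /=]; first by [].
  by case/andP=> exz _ _; case: none; exists (val z) => //; apply: valP.
have ind (A : {set {y | y \in C}}) : independent (induced (induced e U) C) A.
  apply/forall_inP=> y _; apply/forall_inP=> z _.
  by rewrite /induced !C1 e_irr.
by apply/existsP; exists set0; rewrite !ind.
Qed.

Lemma component_edge (U : {set T}) (C : {set {x | x \in U}}) :
    (forall x, x \in U -> exists2 y, y \in U & e x y) ->
    C \in components (induced e U) ->
  exists x y, induced (induced e U) C x y.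
Proof.
move=> U_nbr Cc.
have es' : symmetric (induced e U) by apply: induced_sym.
have [x CE] := componentP _ _ Cc.
have xC : x \in C by rewrite CE inE.
have [y yU exy] := U_nbr _ (valP x).
have yC : exist _ y yU \in C.
  by rewrite (component_connect es' Cc xC); apply: connect1.
by exists (exist (fun z => z \in C) x xC), (exist (fun z => z \in C) _ yC).
Qed.

(** The pair consists of the non-isolated and the isolated vertices of the graph
    induced on the exposable vertices D.  Take a factorization N, of t - 1 edges,
    exposing some j in D.  A block K with weight mu has total exponent at
    least 2 mu + 1, so the number of edges of N that touch K is at least mu + 1, or
    at least mu if j lies in K.  No edge touches two blocks and only one block
    contains j, so summing gives lambda - 1 <= t - 1. *)
Lemma witness_admissible t : short_witness t ->
  exists U V, admissible e U V /\ lambda e U V <= t.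
Proof.
move=> [m sm cov].
pose D := [set x | excluded_middle_informative (exposable e m x)].
have DP x : reflect (exposable e m x) (x \in D).
  by rewrite inE; case: excluded_middle_informative => H; constructor.
pose U := [set x in D | [exists y in D, e x y]].
pose V := D :\: U.
have UVD : U :|: V = D.
  rewrite /V setUC; apply/setP=> x; rewrite in_setU in_setD.
  by case: (boolP (x \in U)); rewrite ?orbF ?andbT //= inE => /andP[->].
have UP x : x \in U -> x \in D /\ exists2 y, y \in D & e x y.
  by rewrite inE => /andP[xD /existsP[y /andP[yD exy]]]; split=> //; exists y.
have UI x y : x \in D -> y \in D -> e x y -> x \in U.
  by move=> xD yD exy; rewrite inE xD; apply/existsP; exists y; rewrite yD.
have U_exp x : x \in U -> exposable e m x by move=> /UP[/DP].
have U_nbr x : x \in U -> exists2 y, y \in U & e x y.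
  move=> /UP[xD [y yD exy]]; exists y => //; apply: UI yD xD _.
  by rewrite e_sym.
have U_closed x y : x \in U -> e x y -> exposable e m y -> y \in U.
  move=> /UP[xD _] exy /DP yD; apply: UI yD xD _; by rewrite e_sym.
have V_indep : independent e V.
  apply/forall_inP=> x /setDP[xD nxU]; apply/forall_inP=> y /setDP[yD _].
  by apply: contra nxU; apply: UI.
have UV : neighbors e U :&: V = set0.
  apply/setP=> y; rewrite in_setI in_set0; apply/negP=> /andP[].
  rewrite inE => /existsP[x /andP[xU exy]] /setDP[/DP yD /negP]; apply.
  exact: U_closed exy yD.
have snb : strongly_nonbipartite (induced e U).
  apply/forall_inP=> C Cc.
  apply: (@exposable_nonbipartite _ _ (fun i : {x | x \in C} => m (val (val i)))).
    exact: component_edge.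
  exact: component_exposable.
exists U, V; split.
  split=> //; first by right.
    rewrite UVD; apply/forallP=> x; apply/forallP=> y.
    have /DP[N eN mN] := valP x; have /DP[N1 eN1 mN1] := valP y.
    have [s [xs ls es]] := exposable_linked eN eN1 mN mN1.
    by apply/connect_inducedP; exists s; split=> //; apply/allP=> w /es/DP.
  apply/forallP=> x; apply/forallP=> y; apply/implyP=> exy.
  have W z : completable e m z -> z \in closed_neighbors e U :|: neighbors e V.
    case/(completable_exposable e_sym) => v vz /DP vD.
    rewrite !inE; move: vD; rewrite -UVD => /setUP[vU|vV].
      by apply/orP; left; apply/orP; left; apply/existsP; exists v; rewrite vU.
    by apply/orP; right; apply/existsP; exists v; rewrite vV.
  by apply/orP; case: (cov _ _ exy) => /W; [left | right].
have [x [y exy]] := e_edge.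
have [j [N eN mN]] : exists j, exposable e m j.
  by case: (cov _ _ exy) => /(completable_exposable e_sym)[v _ vE]; exists v.
have sN : (size N).+1 = t.
  apply/double_inj; rewrite -sm (eq_bigr _ (fun i _ => mN i)) big_split /=.
  by rewrite sum_eq1 sum_degree.
have sep := blocks_separated e_sym V_indep UV U_nbr.
have le := touch_blocks e_sym sep eN.
rewrite -sN -(sum_blocks e U V).
have one : \sum_(B <- blocks e U V) (j \in B.1) <= 1.
  elim: (blocks e U V) sep {le} => [|B s IH] /=; first by rewrite big_nil.
  case/andP=> /allP sB /IH {}IH; rewrite big_cons.
  case: (boolP (j \in B.1)) => jB; last by rewrite add0n.
  rewrite big_seq big1 // => B' /sB /separatedP sBB'.
  apply/eqP; rewrite eqb0; apply/negP => jB'.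
  by have [/eqP] := sBB' _ _ jB jB'.
suff blk B : B \in blocks e U V -> B.2.+1 <= touch N B.1 + (j \in B.1).
  apply: leq_trans (_ : _ <= \sum_(B <- blocks e U V) (touch N B.1 + (j \in B.1))) _.
    by rewrite !big_seq; apply: leq_sum.
  by rewrite big_split /= -addn1; apply: leq_add.
move=> Bb; have := touch_degree N B.1.
have -> : \sum_(i in B.1) degree N i = \sum_(i in B.1) m i - (j \in B.1).
  by rewrite (eq_bigr _ (fun i _ => mN i)) big_split /= sum_in1 addKn.
suff : B.2.*2.+1 <= \sum_(i in B.1) m i.
  move: (\sum_(_ in _) _) (touch _ _) => a b; move: (B.2) => c.
  by case: (j \in B.1) => /=; lia.
move: Bb; rewrite mem_cat => /orP[/mapP[C Cc ->] /=|/mapP[v vV -> /=]].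
  rewrite mem_enum in Cc.
  apply: leq_trans (@mu_star_conn_le _ (induced (induced e U) C) _
    (fun i => m (val (val i))) _ _ _ _) _.
  - by do 2!apply: induced_irr.
  - by do 2!apply: induced_sym.
  - by apply: component_connected Cc; apply: induced_sym.
  - exact: component_edge.
  - exact: component_exposable.
  - rewrite big_imset /=; last by move=> ? ? _ _; apply: val_inj.
    by rewrite (big_sub (mem C)).
rewrite big_set1; move: vV; rewrite mem_enum => /setDP[/DP[Nv _ ->] _].
by rewrite eqxx.
Qed.

End FromWitness.

(** * From admissible pairs to witnesses *)

Section ToWitness.
Variables (T : finType) (e : rel T).
Hypothesis e_sym : symmetric e.
Hypothesis e_irr : irreflexive e.
Hypothesis e_conn : connected e.
Hypothesis e_edge : exists x y, e x y.

Lemma short_witness_gt0 t : short_witness e t -> 0 < t.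
Proof. by case: t => // -[m]. Qed.

Lemma short_witnessS t : short_witness e t -> short_witness e t.+1.
Proof.
move=> [m sm cov]; have [a [b eab]] := e_edge.
pose m' i := (a == i) + (b == i) + m i.
exists m'; first by rewrite !big_split /= !sum_eq1 doubleS -sm.
by move=> x y /cov[]/(completable_edge eab (fun i => erefl (m' i)));
  [left | right].
Qed.

(** When all vertices at the end of an even walk from x0 are exposable, their
    neighbors are completable, and every edge contains such a neighbor. *)
Lemma short_witness_exists : exists t, short_witness e t.
Proof.
have [x0 _] := e_edge; have [m mE] := @even_spread T e x0.
have [t st] : exists t, \sum_i m i = t.*2.+1.
  by apply: (@exposable_odd T e m x0); apply: mE.
exists t.+1; exists m => [|x y exy]; first by rewrite st.
case: (even_or_odd x0 e_conn x) => [cx|[z cz ezx]].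
  by right; apply: exposable_completable exy _; apply: mE.
by left; apply: exposable_completable ezx _; apply: mE.
Qed.

Lemma path_crossing (r : rel T) (P : pred T) x s : path r x s -> P x ->
  ~~ P (last x s) -> exists y z, [/\ r y z, P y, ~~ P z & z \in s].
Proof.
elim: s x => [|z s IH] x /=; first by move=> _ ->.
case/andP=> rxz zs Px nP; case: (boolP (P z)) => Pz.
  have [y [w [ryw Py nw ws]]] := IH z zs Pz nP.
  by exists y, w; split=> //; rewrite inE ws orbT.
by exists x, z; split=> //; apply: mem_head.
Qed.

Lemma pairwise_mem (S : eqType) (r : rel S) (s : seq S) x y : symmetric r ->
  pairwise r s -> x \in s -> y \in s -> x = y \/ r x y.
Proof.
move=> rs; elim: s => //= z s IH /andP[/allP zs /IH {}IH].
rewrite !inE => /predU1P[->|xs] /predU1P[->|ys]; [by left | | | exact: IH].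
  by right; apply: zs.
by right; rewrite rs; apply: zs.
Qed.

(** Blocks are glued one at a time.  As the square graph on the union of U and V
    is connected, some vertex of a new block is within distance two of a vertex
    already treated; distinct blocks are not adjacent, so there is a middle vertex
    to glue along.  A block of weight mu contributes 2 mu + 1 and each gluing adds
    one, which makes the final degree 2 lambda - 1. *)
Lemma admissible_witness (U V : {set T}) :
  admissible e U V -> short_witness e (lambda e U V).
Proof.
move=> [snb V_indep UV con cov].
have U_nbr := nonbipartite_nbr e_irr snb.
have sep := blocks_separated e_sym V_indep UV U_nbr.
have memb := mem_blocks e U V.
set bs := blocks e U V in sep memb.
pose D := U :|: V.
have good B : B \in bs -> exists2 b : T -> nat,
    (\sum_i b i).+1 = (B.2.+1).*2 & forall v, v \in B.1 -> exposable e b v.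
  rewrite mem_cat => /orP[/mapP[C Cc ->] /=|/mapP[v vV -> /=]]; last first.
    exists (fun i => v == i : nat); first by rewrite sum_eq1.
    move=> w /set1P ->; exists [::] => // i; by rewrite degree_nil addn0.
  rewrite mem_enum in Cc.
  have es' : symmetric (induced e U) by apply: induced_sym.
  have nb : ~~ bipartite (induced (induced e U) C).
    case: snb => [U0|/forall_inP]; last by apply.
    have [x CE] := componentP _ _ Cc; exfalso.
    have none z : z \in U -> False by rewrite U0 inE.
    exact: none (valP x).
  have [||||a ea sa] := @mu_star_conn_attained _ (induced (induced e U) C).
  - by do 2!apply: induced_irr.
  - by do 2!apply: induced_sym.
  - exact: component_connected.
  - exact: nb.
  have [|b sb eb] := @extend_exposable _ T (induced (induced e U) C) e
    (fun i => val (val i)) _ (fun x y => erefl) a.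
    by move=> i j /val_inj/val_inj.
  exists b; first by rewrite sb sa.
  move=> _ /imsetP[w wC ->].
  exact: (eb (exist (fun z => z \in C) w wC)).
have nonempty B : B \in bs -> exists v, v \in B.1.
  rewrite mem_cat => /orP[/mapP[C Cc ->] /=|/mapP[v vV -> /=]].
    rewrite mem_enum in Cc; have [x CE] := componentP _ _ Cc.
    by exists (val x); apply: imset_f; rewrite CE inE.
  by exists v; apply: set11.
have uniq_block x B B' :
    B \in bs -> B' \in bs -> x \in B.1 -> x \in B'.1 -> B = B'.
  move=> Bb Bb' xB xB'.
  case: (pairwise_mem (separated_sym e_sym) sep Bb Bb') => // /separatedP sBB'.
  by have [/eqP] := sBB' _ _ xB xB'.
have bs_uniq : uniq bs.
  rewrite uniq_pairwise; apply: (sub_in_pairwise (P := [in bs])) sep; last exact/allP.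
  move=> B B' Bb _ /separatedP sBB'; have [v vB] := nonempty B Bb.
  apply/eqP=> BB'; rewrite -BB' in sBB'.
  by have [/eqP] := sBB' v v vB vB.
have grow : forall n rest done (m : T -> nat), size rest = n ->
    perm_eq (done ++ rest) bs -> done != [::] ->
    (\sum_i m i).+1 = (\sum_(B <- done) B.2.+1).*2 ->
    (forall B v, B \in done -> v \in B.1 -> exposable e m v) ->
  exists2 m' : T -> nat, (\sum_i m' i).+1 = (\sum_(B <- bs) B.2.+1).*2 &
    forall v, v \in D -> exposable e m' v.
  elim=> [|n IH] rest done m srest.
    rewrite (size0nil srest) cats0 => pdone _ sm expo; exists m.
      by rewrite sm (perm_big _ pdone).
    by move=> v /memb[B Bb]; apply: expo; rewrite (perm_mem pdone).
  move=> pbs ndone sm expo.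
  have mem_bs B : (B \in bs) = (B \in done) || (B \in rest).
    by rewrite -(perm_mem pbs) mem_cat.
  have [B0 B0d] : exists B, B \in done.
    by case: (done) ndone => // B s _; exists B; apply: mem_head.
  have [B1 B1r] : exists B, B \in rest.
    by case: (rest) srest => // B s _; exists B; apply: mem_head.
  have [v0 v0B] : exists v, v \in B0.1 by apply: nonempty; rewrite mem_bs B0d.
  have [v1 v1B] : exists v, v \in B1.1.
    by apply: nonempty; rewrite mem_bs B1r orbT.
  have v0D : v0 \in D by apply/memb; exists B0; rewrite // mem_bs B0d.
  have v1D : v1 \in D by apply/memb; exists B1; rewrite // mem_bs B1r orbT.
  have disj B : B \in done -> B \in rest -> False.
    move=> Bd Br; move: bs_uniq; rewrite -(perm_uniq pbs) cat_uniq.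
    by case/and3P=> _ /hasP[]; exists B.
  pose P x := has (fun B : {set T} * nat => x \in B.1) done.
  have /forallP/(_ (exist _ v0 v0D))/forallP/(_ (exist _ v1 v1D)) := con.
  case/connect_inducedP=> s [/= v0s ls aD].
  have [||y [z [syz /hasP[B Bd yB] nz zs]]] := path_crossing v0s (P := P).
  - by apply/hasP; exists B0.
  - rewrite ls; apply/hasP=> -[B Bd v1B'].
    have BB1 : B = B1 by apply: uniq_block v1B' v1B; rewrite mem_bs ?Bd ?B1r ?orbT.
    by apply: disj B1r; rewrite -BB1.
  have /memb[B' B'b zB'] : z \in D by apply: (allP aD).
  have B'r : B' \in rest.
    move: B'b; rewrite mem_bs => /orP[B'd|//].
    by case/negP: nz; apply/hasP; exists B'.
  have nyz : ~~ e y z.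
    have Bb : B \in bs by rewrite mem_bs Bd.
    have [BB'|/separatedP sBB'] :=
      pairwise_mem (separated_sym e_sym) sep Bb B'b.
      by case: (disj B Bd); rewrite BB'.
    by have [] := sBB' _ _ yB zB'.
  have [w eyw ewz] := square_inv syz nyz.
  have [b sb eb] := good B' B'b.
  pose m' i := m i + (w == i) + b i.
  have G := glue (expo B y Bd yB) eyw ewz (eb z zB') (fun i => erefl (m' i)).
  apply: (IH (rem B' rest) (B' :: done) m') => //.
  - by rewrite size_rem // srest.
  - apply: perm_trans pbs; rewrite perm_sym.
    apply: perm_trans (_ : perm_eq _ (done ++ B' :: rem B' rest)) _.
      by rewrite perm_cat2l perm_to_rem.
    by rewrite -cat1s perm_catCA.
  - rewrite big_cons /m' !big_split /= sum_eq1 doubleD -sb -sm.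
    by move: (\sum_i m i) (\sum_i b i) => p q; count_lia.
  - move=> C v; rewrite inE => /predU1P[->|Cd] vC; apply: G.
      by right; apply: eb.
    by left; apply: expo Cd vC.
have [x [y exy]] := e_edge.
have [v vD] : exists v, v \in D.
  have /forallP/(_ x)/forallP/(_ y)/implyP/(_ exy) := cov.
  have H z : z \in closed_neighbors e U :|: neighbors e V -> exists v, v \in D.
    case/setUP=> [/setUP[|zU]|]; last 1 first.
    - by rewrite inE => /existsP[v /andP[vV _]]; exists v; rewrite inE vV orbT.
    - by rewrite inE => /existsP[v /andP[vU _]]; exists v; rewrite inE vU.
    - by exists z; rewrite inE zU.
  by case/orP=> /H.
have /memb[B Bb vB] := vD.
have [b sb eb] := good B Bb.
have [|||C w|m sm em] := grow (size (rem B bs)) (rem B bs) [:: B] b (erefl _).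
- by rewrite perm_sym perm_to_rem.
- by [].
- by rewrite big_seq1.
- by rewrite inE => /eqP ->; apply: eb.
rewrite -(sum_blocks e U V); exists m => // {}x {}y {}exy.
have W z : z \in closed_neighbors e U :|: neighbors e V -> completable e m z.
  case/setUP=> [/setUP[|zU]|].
  - rewrite inE => /existsP[u /andP[uU euz]].
    by apply: exposable_completable euz _; apply: em; rewrite inE uU.
  - have [u uU ezu] := U_nbr z zU.
    apply: (@exposable_completable _ _ _ u); first by rewrite e_sym.
    by apply: em; rewrite inE uU.
  - rewrite inE => /existsP[u /andP[uV euz]].
    by apply: exposable_completable euz _; apply: em; rewrite inE uV orbT.
have /forallP/(_ x)/forallP/(_ y)/implyP/(_ exy)/orP[/W|/W] := cov;
  by [left | right].
Qed.

End ToWitness.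

(** * Powers of the edge ideal *)

Section IdealGen.
Local Open Scope ring_scope.
Variable R : comNzRingType.
Implicit Types (A : R -> Prop) (f g : R).

Lemma ideal_gen_in A f : A f -> ideal_gen A f.
Proof.
move=> Af; exists [:: (1, f)]; split; last by rewrite big_seq1 mul1r.
by move=> p; rewrite inE => /eqP ->.
Qed.

Lemma ideal_gen_ideal A : is_ideal (ideal_gen A).
Proof.
split.
- by exists [::]; split=> //; rewrite big_nil.
- move=> _ _ [s [sA ->]] [t [tA ->]]; exists (s ++ t); split.
    by move=> p; rewrite mem_cat => /orP[/sA|/tA].
  by rewrite big_cat.
- move=> f _ [s [sA ->]]; exists [seq (f * p.1, p.2) | p <- s]; split.
    by move=> p /mapP[q qs ->]; exact: (sA q qs).
  by rewrite big_map mulr_sumr; apply: eq_bigr => p _; rewrite mulrA.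
Qed.

Lemma ideal_gen_sub A (I : R -> Prop) : is_ideal I -> (forall f, A f -> I f) ->
  forall f, ideal_gen A f -> I f.
Proof.
move=> [I0 ID IM] AI _ [s [sA ->]].
elim: s sA => [|p s IH] sA; first by rewrite big_nil.
rewrite big_cons; apply: ID; first by apply/IM/AI/sA; rewrite mem_head.
by apply: IH => q qs; apply: sA; rewrite inE qs orbT.
Qed.

Lemma ideal_sum (I : R -> Prop) (J : eqType) (s : seq J) (F : J -> R) :
  is_ideal I -> (forall j, j \in s -> I (F j)) -> I (\sum_(j <- s) F j).
Proof.
move=> [I0 ID IM]; elim: s => [|j s IH] sI; first by rewrite big_nil.
rewrite big_cons; apply: ID; first by apply/sI/mem_head.
by apply: IH => i js; apply: sI; rewrite inE js orbT.
Qed.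

End IdealGen.

Section EdgeIdeal.
Local Open Scope ring_scope.
Variables (k : fieldType) (n : nat) (e : rel 'I_n).
Local Notation S := {mpoly k[n]}.
Implicit Types (m u : 'X_{1..n}) (f g : S) (W : {set 'I_n}).

Definition covered (t : nat) m : Prop :=
  exists N, [/\ edges e N, size N = t & forall i, (degree N i <= m i)%N].

Definition supp_covered (t : nat) f : Prop :=
  forall m, m \in msupp f -> covered t m.

Lemma coveredD t1 t2 m1 m2 :
  covered t1 m1 -> covered t2 m2 -> covered (t1 + t2) (m1 + m2)%MM.
Proof.
move=> [N1 [eN1 <- dN1]] [N2 [eN2 <- dN2]]; exists (N1 ++ N2); split.
- by rewrite edges_cat eN1.
- by rewrite size_cat.
- by move=> i; rewrite degree_cat mnmDE leq_add.
Qed.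

Lemma covered0 m : covered 0 m.
Proof. by exists [::]; split=> // i; rewrite degree_nil. Qed.

Lemma supp_coveredM t1 t2 f g :
  supp_covered t1 f -> supp_covered t2 g -> supp_covered (t1 + t2) (f * g).
Proof.
move=> cf cg m /msuppM_le /allpairsP[[m1 m2] /= [m1f m2g ->]].
by apply: coveredD; [apply: cf | apply: cg].
Qed.

Lemma supp_covered_ideal t : is_ideal (supp_covered t).
Proof.
split.
- by move=> m; rewrite msupp0.
- by move=> f g cf cg m /msuppD_le; rewrite mem_cat => /orP[/cf|/cg].
- move=> f g cg; rewrite -[t]add0n; apply: supp_coveredM => // m _.
  exact: covered0.
Qed.

(** Products of such polynomials then give one inclusion of the description of
    I^t. *)
Lemma edge_ideal_covered f : edge_ideal k e f -> supp_covered 1 f.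
Proof.
apply: ideal_gen_sub; first exact: supp_covered_ideal.
move=> _ [i [j [eij ->]]] m; rewrite -mpolyXD msuppX inE => /eqP ->.
exists [:: (i, j)]; split=> [||l] //; first by rewrite edges_cons eij.
by rewrite degree_cons degree_nil mnmDE !mnm1E addn0.
Qed.

Lemma monomial_edges N m : (forall i, m i = degree N i) ->
  'X_[m] = \prod_(p <- N) ('X_(p.1) * 'X_(p.2)) :> S.
Proof.
elim: N m => [|[x y] N IH] m mN.
  rewrite big_nil -mpolyX0; congr 'X_[_]; apply/mnmP=> i.
  by rewrite mN degree_nil mnm0E.
rewrite big_cons /= -(IH [multinom degree N i | i < n]); last first.
  by move=> i; rewrite mnmE.
rewrite -!mpolyXD; congr 'X_[_]; apply/mnmP=> i.
by rewrite mN degree_cons !mnmDE !mnm1E mnmE.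
Qed.

Lemma edge_ideal_powP t f : ideal_pow (edge_ideal k e) t f <-> supp_covered t f.
Proof.
split.
  apply: ideal_gen_sub; first exact: supp_covered_ideal.
  move=> _ [h [hI ->]]; elim: t h hI => [|t IH] h hI.
    by move=> m _; apply: covered0.
  rewrite big_ord_recl; apply: (@supp_coveredM 1 t).
    exact/edge_ideal_covered/hI.
  by apply: IH => i; apply: hI.
move=> cf; rewrite [f]mpolyE; apply: ideal_sum; first exact: ideal_gen_ideal.
move=> m /cf[N [eN sN dN]].
pose d := [multinom degree N i | i < n].
have -> : m = ((m - d) + d)%MM.
  by rewrite submK //; apply/mnm_lepP=> i; rewrite mnmE.
rewrite mpolyXD -mul_mpolyC mulrA.
have [_ _ IM] := @ideal_gen_ideal S (fun f =>
    exists h : 'I_t -> S, (forall i, edge_ideal k e (h i)) /\ f = \prod_(i < t) h i).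
apply: IM; apply: ideal_gen_in; rewrite -sN.
exists (fun i => let p := tnth (in_tuple N) i in 'X_(p.1) * 'X_(p.2)); split.
  move=> i; apply: ideal_gen_in.
  exists (tnth (in_tuple N) i).1, (tnth (in_tuple N) i).2; split=> //.
  by have /allP := eN; apply; apply: mem_tnth.
rewrite (@monomial_edges N); last by move=> i; rewrite mnmE.
exact: big_tnth.
Qed.

Definition monomial_prime W : S -> Prop :=
  fun f => forall m, m \in msupp f -> exists2 i, i \in W & (0 < m i)%N.

(** The kernel of the substitution of 0 for the variables in W, whose values lie
    in a domain. *)
Lemma monomial_prime_prime W : prime_ideal (monomial_prime W).
Proof.
pose h i : S := if i \in W then 0 else 'X_i.
pose avoids m := [forall i in W, m i == 0%N].
have hE m : mmap1 h m = if avoids m then 'X_[m] else 0.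
  rewrite /mmap1; case: ifP => [/forall_inP av|/negbT].
    rewrite mpolyXE_id; apply: eq_bigr => i _; rewrite /h.
    by case: ifP => // iW; rewrite (eqP (av i iW)) !expr0.
  rewrite negb_forall => /existsP[i]; rewrite negb_imply => /andP[iW mi].
  by rewrite (bigD1 i) //= /h iW expr0n (negbTE mi) mul0r.
pose phi := mmap (@mpolyC n k) h.
have phiE f m : (phi f)@_m = if avoids m then f@_m else 0.
  rewrite /phi /mmap raddf_sum /=.
  under eq_bigr => m' _ do rewrite mul_mpolyC mcoeffZ hE.
  have E m' : f@_m' * (if avoids m' then 'X_[m'] else 0 : S)@_m
      = (if avoids m then f@_m' * (m' == m)%:R else 0).
    case: (eqVneq m' m) => [->|nm].
      by case: ifP => _; rewrite ?mcoeffX ?eqxx // mcoeff0 mulr0.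
    by case: ifP => _; rewrite ?mcoeffX ?(negbTE nm) ?mcoeff0 mulr0 ?if_same.
  under eq_bigr => m' _ do rewrite E.
  case: ifP => _; last by rewrite big1.
  rewrite [in RHS](mpolyE f) raddf_sum /=; apply: eq_bigr => m' _.
  by rewrite mcoeffZ mcoeffX.
have PE f : monomial_prime W f <-> phi f = 0.
  split=> [Pf|f0 m mf].
    apply/mpolyP=> m; rewrite mcoeff0 phiE; case: ifP => // /forall_inP av.
    apply/eqP; rewrite mcoeff_eq0; apply/negP => /Pf[i iW mi].
    by rewrite (eqP (av i iW)) in mi.
  have : ~~ avoids m.
    apply/negP => av; have := phiE f m.
    by rewrite f0 mcoeff0 av => /esym/eqP; rewrite mcoeff_eq0 mf.
  rewrite negb_forall => /existsP[i]; rewrite negb_imply -lt0n => /andP[iW mi].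
  by exists i.
have phiM : {morph phi : f g / f * g} by move=> f g; rewrite /phi rmorphM.
split.
- split.
  + by move=> m; rewrite msupp0.
  + by move=> f g Pf Pg m /msuppD_le; rewrite mem_cat => /orP[/Pf|/Pg].
  + by move=> f g /PE g0; apply/PE; rewrite phiM g0 mulr0.
- by move=> /PE; rewrite /phi rmorph1 => /eqP; rewrite oner_eq0.
- move=> f g /PE; rewrite phiM => /eqP; rewrite mulf_eq0.
  by case/orP=> /eqP/PE; [left | right].
Qed.

Lemma colon_monomial W t m :
    (forall u, covered t (m + u)%MM <-> exists2 i, i \in W & (0 < u i)%N) ->
  same_ideal (colon (ideal_pow (edge_ideal k e) t) 'X_[m]) (monomial_prime W).
Proof.
move=> cov g; rewrite /colon; split=> [/edge_ideal_powP cg u ug|Pg].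
  apply/cov; apply: cg; rewrite (perm_mem (msuppMX _ _)).
  by apply: map_f.
apply/edge_ideal_powP => u'; rewrite (perm_mem (msuppMX _ _)).
by case/mapP=> u ug ->; apply/cov/Pg.
Qed.

End EdgeIdeal.

(** * v-numbers of the powers *)

Section VNumber.
Local Open Scope ring_scope.
Variables (k : fieldType) (n : nat) (e : rel 'I_n).
Hypothesis e_sym : symmetric e.
Hypothesis e_irr : irreflexive e.
Hypothesis e_edge : exists x y, e x y.
Local Notation S := {mpoly k[n]}.
Local Notation I := (edge_ideal k e).
Implicit Types (m u : 'X_{1..n}) (f g : S) (W : {set 'I_n}).

Lemma sum_covered t m : covered e t m -> (t.*2 <= mdeg m)%N.
Proof.
move=> [N [_ <- dN]]; rewrite -sum_degree mdegE; exact: leq_sum.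
Qed.

(** In degree 2t - 1 there is no room left: t edges dominated by m x_i use all
    of it. *)
Lemma covered_completable t m i : covered e t (U_(i) + m)%MM ->
  (mdeg m).+1 = t.*2 -> completable e m i.
Proof.
move=> [N [eN sN dN]] sm; exists N => // j.
have le l : (degree N l <= m l + (i == l))%N.
  by have := dN l; rewrite mnmDE mnm1E addnC.
apply/eqP; rewrite eqn_leq le andbT leqNgt; apply/negP => lt.
have : (\sum_l degree N l < \sum_l (m l + (i == l)))%N.
  rewrite (bigD1 j) //= [ltnRHS](bigD1 j) //= -addSn; apply: leq_add => //.
  exact: leq_sum.
by rewrite sum_degree sN big_split /= sum_eq1 -mdegE addn1 sm ltnn.
Qed.

Lemma prime_expr (P : S -> Prop) g t : prime_ideal P -> P (g ^+ t) -> P g.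
Proof.
move=> [_ nP1 mP]; elim: t => [/nP1//|t IH].
by rewrite exprS => /mP[|/IH].
Qed.

Lemma associated_witness t (P : S -> Prop) f : prime_ideal P ->
    same_ideal (colon (ideal_pow I t) f) P ->
  exists m, (mdeg m).+1 = msize f /\
    forall x y, e x y -> covered e t (U_(x) + m)%MM \/ covered e t (U_(y) + m)%MM.
Proof.
move=> Pp cP; have [idP nP1 mP] := Pp.
have nf0 : f != 0.
  apply/eqP=> f0; apply/nP1/cP/edge_ideal_powP => m.
  by rewrite f0 mulr0 msupp0.
exists (mlead f); split=> [|x y exy]; first exact: mlead_deg.
have cov z : P 'X_z -> covered e t (U_(z) + mlead f)%MM.
  move=> /cP/edge_ideal_powP; apply.
  by rewrite mulrC (perm_mem (msuppMX _ _)); apply: map_f; apply: mlead_supp.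
have : P ('X_x * 'X_y).
  apply: (prime_expr (t := t) Pp); apply/cP; rewrite /colon mulrC.
  have [_ _ IM] := ideal_gen_ideal (fun f : S =>
    exists h : 'I_t -> S, (forall i, I (h i)) /\ f = \prod_(i < t) h i).
  apply: IM; apply: ideal_gen_in; exists (fun=> 'X_x * 'X_y); split.
    by move=> _; apply: ideal_gen_in; exists x, y.
  by rewrite prodr_const card_ord.
by case/mP=> /cov; [left | right].
Qed.

Lemma short_witness_colon t : short_witness e t ->
  exists P f, [/\ prime_ideal P, same_ideal (colon (ideal_pow I t) f) P
    & (msize f).-1.+1 = t.*2].
Proof.
move=> [m sm cov].
pose W := [set x | excluded_middle_informative (completable e m x)].
have WP x : reflect (completable e m x) (x \in W).
  by rewrite inE; case: excluded_middle_informative => H; constructor.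
pose mm := [multinom m i | i < n].
exists (monomial_prime W), 'X_[mm]; split; first exact: monomial_prime_prime.
  apply: colon_monomial => u; split=> [[N [eN sN dN]]|[i /WP[N eN mN] ui]].
    have [|i ui /WP] := completable_cover (u := u) e_sym e_irr cov sm eN sN.
      by move=> i; have := dN i; rewrite mnmDE mnmE.
    by exists i.
  exists N; split=> //; last first.
    move=> j; rewrite -mN mnmDE mnmE leq_add2l.
    by case: (eqVneq i j) => [<-|].
  apply/double_inj; rewrite -sm -sum_degree.
  by rewrite -(eq_bigr _ (fun j _ => mN j)) big_split /= sum_eq1 addn1.
rewrite msizeX /= mdegE -sm; congr _.+1.
by apply: eq_bigr => i _; rewrite mnmE.
Qed.

(** With A a maximal independent set, its complement W is a minimal vertex cover.
    Raising the variables of A to the power t makes I^t behave like the t-th power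
    of the ideal (W), because every vertex of W has a neighbor in A; the factor
    x_j^(t-1) with j in W then has colon ideal (W). *)
Lemma associated_exists t : (0 < t)%N -> exists P f,
  prime_ideal P /\ same_ideal (colon (ideal_pow I t) f) P.
Proof.
case: t => // t _.
have [A /maxsetP[iA maxA]] : {A | maxset (fun A => independent e A) A}.
  by apply: ex_maxset; exists set0; apply/forall_inP => x; rewrite inE.
have nbr i : i \notin A -> exists2 a, a \in A & e i a.
  move=> iA'; apply: NNPP => none; case/negP: (iA').
  have nei a : a \in A -> ~~ e i a.
    by move=> aA; apply/negP=> eia; apply: none; exists a.
  rewrite -(maxA (i |: A)) ?setU11 ?subsetUr //.
  apply/forall_inP=> x /setU1P[->|xA]; apply/forall_inP=> y /setU1P[->|yA].
  - by rewrite e_irr.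
  - exact: nei.
  - by rewrite e_sym nei.
  - by have /forall_inP/(_ x xA)/forall_inP/(_ y yA) := iA.
have [j jA] : exists j, j \notin A.
  have [x [y exy]] := e_edge; case: (boolP (x \in A)) => xA; last by exists x.
  exists y; apply: contraL exy => yA.
  by have /forall_inP/(_ x xA)/forall_inP/(_ y yA) := iA.
pose mm := [multinom if i \in A then t.+1 else (t * (j == i))%N | i < n].
exists (monomial_prime (~: A)), 'X_[mm]; split; first exact: monomial_prime_prime.
apply: colon_monomial => u; split=> [[N [eN sN dN]]|[i iA' ui]].
  apply: NNPP => none.
  have u0 i : i \notin A -> u i = 0%N.
    move=> iA'; case: (posnP (u i)) => // ui; case: none.
    by exists i; rewrite ?inE.
  have le : (\sum_(i in ~: A) degree N i <= \sum_(i in ~: A) t * (j == i))%N.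
    apply: leq_sum => i; rewrite inE => iA'; apply: leq_trans (dN i) _.
    by rewrite mnmDE mnmE (negbTE iA') u0 ?addn0.
  move: le; rewrite -big_distrr /= sum_in1 inE jA muln1 leqNgt => /negP; apply.
  rewrite -sN; elim: N eN {sN dN} => [|[x y] N IH] //.
  rewrite edges_cons => /andP[exy /IH le].
  under eq_bigr do rewrite degree_cons.
  rewrite big_split /= big_split /= !sum_in1 -add1n leq_add // !inE.
  case: (boolP (x \in A)) => xA //; case: (boolP (y \in A)) => yA //.
  by have /forall_inP/(_ x xA)/forall_inP/(_ y yA)/negP := iA.
rewrite inE in iA'; have [a aA eja] := nbr j jA; have [b bA eib] := nbr i iA'.
exists ((i, b) :: nseq t (j, a)).
have dE l : degree (nseq t (j, a)) l = (t * ((j == l) + (a == l)))%N.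
  elim: (t) => [|s IH] /=; first by rewrite degree_nil.
  by rewrite degree_cons IH mulSn.
split; first by rewrite edges_cons eib; apply/allP => p /nseqP[->].
  by rewrite /= size_nseq.
move=> l; rewrite degree_cons dE mnmDE mnmE.
case: (boolP (l \in A)) => lA.
  have -> : (i == l) = false by apply/eqP=> E; rewrite E lA in iA'.
  have -> : (j == l) = false by apply/eqP=> E; rewrite E lA in jA.
  rewrite !add0n; apply: leq_trans (leq_addr _ _).
  rewrite -[t.+1]add1n leq_add ?leq_b1 //.
  by case: (a == l); rewrite ?muln1 ?muln0.
have -> : (a == l) = false by apply/eqP=> E; rewrite -E aA in lA.
have -> : (b == l) = false by apply/eqP=> E; rewrite -E bA in lA.
rewrite !addn0 addnC leq_add2l; by case: eqP => [<-|].
Qed.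

Lemma v_numberP t : (0 < t)%N ->
  (t.*2 <= (v_number (ideal_pow I t)).+1)%N /\
  ((v_number (ideal_pow I t)).+1 = t.*2 <-> short_witness e t).
Proof.
move=> t0.
have low P f : prime_ideal P -> same_ideal (colon (ideal_pow I t) f) P ->
    (t.*2 <= (msize f).-1.+1)%N /\ ((msize f).-1.+1 = t.*2 -> short_witness e t).
  move=> Pp cP; have [m [<- cov]] := associated_witness Pp cP.
  have [x [y exy]] := e_edge; split=> [|sm].
    by case: (cov _ _ exy) => /sum_covered; rewrite mdegD mdeg1.
  exists m; first by rewrite -mdegE sm.
  by move=> x' y' /cov[] /covered_completable /(_ sm); [left | right].
have v_atP P f : same_ideal (colon (ideal_pow I t) f) P ->
    (v_at (ideal_pow I t) P <= (msize f).-1)%N /\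
    exists2 f, same_ideal (colon (ideal_pow I t) f) P &
      v_at (ideal_pow I t) P = (msize f).-1.
  move=> cP; have A : exists f : S, same_ideal (colon (ideal_pow I t) f) P
      /\ (msize f).-1 = (msize f).-1 by exists f.
  have [[f' [cP' vE]] min] := min_ofP (A := fun d => exists f : S,
    same_ideal (colon (ideal_pow I t) f) P /\ d = (msize f).-1)
    (ex_intro _ f (conj cP erefl)).
  split; last by exists f'.
  by apply: min; exists f.
have v_le P f : prime_ideal P -> same_ideal (colon (ideal_pow I t) f) P ->
    (v_number (ideal_pow I t) <= (msize f).-1)%N.
  move=> Pp cP; have [le _] := v_atP P f cP; apply: leq_trans le.
  have A : exists Q, associated (ideal_pow I t) Q /\
    v_at (ideal_pow I t) P = v_at (ideal_pow I t) Q.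
    by exists P; split=> //; split=> //; exists f.
  exact: (min_ofP (A := fun d => exists Q, associated (ideal_pow I t) Q /\
    d = v_at (ideal_pow I t) Q) A).2.
have [P [f [Pp cP vE]]] : exists P f, [/\ prime_ideal P,
    same_ideal (colon (ideal_pow I t) f) P &
    v_number (ideal_pow I t) = (msize f).-1].
  have [P0 [f0 [Pp0 cP0]]] := associated_exists t0.
  have A : exists Q, associated (ideal_pow I t) Q /\
    v_at (ideal_pow I t) P0 = v_at (ideal_pow I t) Q.
    by exists P0; split=> //; split=> //; exists f0.
  have [[P [[Pp [f cP]] vE]] _] := min_ofP (A := fun d => exists Q,
    associated (ideal_pow I t) Q /\ d = v_at (ideal_pow I t) Q) A.
  have [_ [f' cP' vE']] := v_atP P f cP.
  by exists P, f'; split=> //; rewrite -vE'.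
have [lowf wit] := low P f Pp cP.
rewrite vE; split=> //; split=> //.
move=> /short_witness_colon[P' [f' [Pp' cP' sf']]].
apply/eqP; rewrite eqn_leq lowf andbT -sf' ltnS -vE.
exact: v_le cP'.
Qed.

Lemma vstab_short_witness : connected e ->
  vstab I = min_of (short_witness e).
Proof.
move=> e_conn; have [t1 w1] := short_witness_exists e_conn e_edge.
have [wt mint] := min_ofP w1.
set t := min_of _ in wt mint *.
have t0 := short_witness_gt0 wt.
have wit s : (t <= s)%N -> short_witness e s.
  by move=> /subnK <-; elim: (s - t)%N => // d; apply: short_witnessS.
have vE s : (t <= s)%N ->
    (v_number (ideal_pow I s))%:Z = (2 : int) * s%:Z + (- 1 : int).
  move=> ts; have s0 := leq_trans t0 ts.
  have [_ [_ /(_ (wit s ts))]] := v_numberP s0; move: (v_number _) => v; lia.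
apply: min_of_eq; split; first by split=> //; exists (2 : int), (- 1 : int).
move=> s [s0 [a [b lin]]]; apply: mint; apply: (v_numberP s0).2.1.
(* The linear function agrees with 2 r - 1 at two consecutive exponents
   r >= t, hence everywhere from s on, in particular at s. *)
have := lin s (leqnn s).
have := lin _ (leq_maxl s t); rewrite vE ?leq_maxr //.
have := lin (maxn s t).+1 (leqW (leq_maxl s t)).
rewrite vE; last exact: leqW (leq_maxr s t).
move: (v_number _) (maxn s t) => v r.
rewrite !intS => E1 E2; have aE : a = 2 :> int by lia.
subst a; lia.
Qed.

End VNumber.

Theorem theorem1p2 (k : fieldType) (n : nat) (e : rel 'I_n)
    (e_sym : symmetric e) (e_irr : irreflexive e)
    (e_conn : connected e) (e_edge : exists i j, e i j) :
  is_min (fun l => exists U V : {set 'I_n},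
            admissible e U V /\ l = lambda e U V)
         (vstab (edge_ideal k e)).
Proof.
have [t1 w1] := short_witness_exists e_conn e_edge.
have [wt mint] := min_ofP w1.
rewrite vstab_short_witness //; split.
  have [U [V [adm le]]] := witness_admissible e_sym e_irr e_edge wt.
  exists U, V; split=> //; apply/eqP; rewrite eqn_leq le andbT.
  by apply: mint; apply: admissible_witness.
by move=> _ [U [V [adm ->]]]; apply: mint; apply: admissible_witness.
Qed.
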